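(* Let $n\geq 0$. If $X$ is a continuum, then $\mathbf{fwrk}_n(X)$ is a countable ordinal. Conversely, for any countable ordinal $\lambda\geq 0$, there exists a continuum $X_{\lambda}$ such that $\mathbf{fwrk}_n(X_{\lambda})=\lambda$ and such that $\mathbf{fw}_n^{\lambda-1}(X_{\lambda})= S^n$ (up to homeomorphism) whenever $\lambda$ is a successor ordinal.
   Context: All topological spaces are Hausdorff and ''map'' means continuous function. A continuum is a compact metrizable space. $S^n$ is the unit $n$-sphere. A map $f:S^n\to X$ is essential if it is not null-homotopic. A sequence of maps $f_k:S^n\to X$, $k\in\mathbb{N}$, converges to $x\in X$ if for every neighborhood $U$ of $x$ there is $K$ with $\mathrm{Im}(f_k)\subseteq U$ for all $k\geq K$. The free $\pi_n$-wild set $\mathbf{fw}_n(X)$ of a space $X$ is the subspace of all points $x\in X$ for which there is a sequence of essential unbased maps $f_k:S^n\to X$ converging to $x$. Define by transfinite recursion $\mathbf{fw}_n^0(X)=X$, $\mathbf{fw}_n^{\kappa+1}(X)=\mathbf{fw}_n(\mathbf{fw}_n^{\kappa}(X))$ (with the subspace topology on $\mathbf{fw}_n^{\kappa}(X)$), and $\mathbf{fw}_n^{\kappa}(X)=\bigcap_{\mu<\kappa}\mathbf{fw}_n^{\mu}(X)$ for limit ordinals $\kappa$. The free $\pi_n$-wild rank $\mathbf{fwrk}_n(X)$ is the smallest ordinal $\kappa_1$ such that $\mathbf{fw}_n^{\kappa_1}(X)=\mathbf{fw}_n^{\kappa}(X)$ for all $\kappa\geq\kappa_1$. For a successor ordinal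 $\lambda=\mu+1$, $\lambda-1$ denotes $\mu$. *)

(* Defs.v *)
From HB Require Import structures.
From mathcomp Require Import all_boot all_order all_algebra.
From mathcomp Require Import all_classical all_reals all_analysis.

Set Implicit Arguments.
Unset Strict Implicit.
Unset Printing Implicit Defensive.

Import Order.TTheory GRing.Theory Num.Theory.
Import numFieldTopology.Exports.

Local Open Scope classical_set_scope.
Local Open Scope ring_scope.

(* Ordinals are represented by well-ordered types, taken up to [ord_iso].     *)
Record ordinal_type := OrdinalType {
  ord_sort :> Type;
  ord_lt : ord_sort -> ord_sort -> Prop;
  ord_lt_wf : well_founded ord_lt;
  ord_lt_trans : forall x y z, ord_lt x y -> ord_lt y z -> ord_lt x z;
  ord_lt_total : forall x y, [\/ ord_lt x y, x = y | ord_lt y x] }.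

Definition ord_iso (k l : ordinal_type) : Prop :=
  exists (f : k -> l) (g : l -> k),
    [/\ cancel f g, cancel g f & forall x y, ord_lt x y <-> ord_lt (f x) (f y)].

Definition initial_embedding (k l : ordinal_type) (f : k -> l) : Prop :=
  (forall x y, ord_lt x y -> ord_lt (f x) (f y)) /\
  (forall x z, ord_lt z (f x) -> exists y, f y = z).

Definition ord_le (k l : ordinal_type) : Prop :=
  exists f : k -> l, initial_embedding f.

Definition succ_lt (k : ordinal_type) (x y : option k) : Prop :=
  match x, y with
  | Some a, Some b => ord_lt a b
  | Some _, None => True
  | None, _ => False
  end.

Lemma succ_lt_wf (k : ordinal_type) : well_founded (@succ_lt k).
Proof.
have accS (a : k) : Acc (@succ_lt k) (Some a).
  elim/(well_founded_ind (@ord_lt_wf k)): a => a IH.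
  constructor=> -[b|] /= ba; first exact: IH.
  by case: ba.
case=> [a|]; first exact: accS.
constructor=> -[b|] /= ba; first exact: accS.
by case: ba.
Qed.

Lemma succ_lt_trans (k : ordinal_type) (x y z : option k) :
  succ_lt x y -> succ_lt y z -> succ_lt x z.
Proof. by case: x y z => [a|] [b|] [c|] //=; exact: ord_lt_trans. Qed.

Lemma succ_lt_total (k : ordinal_type) (x y : option k) :
  [\/ succ_lt x y, x = y | succ_lt y x].
Proof.
case: x y => [a|] [b|] /=.
- by case: (ord_lt_total a b) => [ab|->|ba];
    [apply: Or31|apply: Or32|apply: Or33].
- by apply: Or31.
- by apply: Or33.
- by apply: Or32.
Qed.

(* The ordinal k + 1: a new greatest element [None] is added to k.            *)
Definition ord_succ (k : ordinal_type) : ordinal_type :=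
  @OrdinalType (option k) (@succ_lt k) (@succ_lt_wf k)
    (@succ_lt_trans k) (@succ_lt_total k).

(* The order type of the initial segment [set v | v < w].                     *)
Definition seg_lt (k : ordinal_type) (w : k) (x y : {v : k | ord_lt v w}) :=
  ord_lt (sval x) (sval y).

Lemma seg_lt_wf (k : ordinal_type) (w : k) : well_founded (@seg_lt k w).
Proof.
case=> a; elim/(well_founded_ind (@ord_lt_wf k)): a => a IH aw.
constructor=> -[b bw] ba; exact: (IH b ba bw).
Qed.

Lemma seg_lt_trans (k : ordinal_type) (w : k) (x y z : {v : k | ord_lt v w}) :
  seg_lt x y -> seg_lt y z -> seg_lt x z.
Proof. exact: ord_lt_trans. Qed.

Lemma seg_lt_total (k : ordinal_type) (w : k) (x y : {v : k | ord_lt v w}) :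
  [\/ seg_lt x y, x = y | seg_lt y x].
Proof.
case: (ord_lt_total (sval x) (sval y)) => [xy|xy|yx];
  [exact: Or31|apply: Or32|exact: Or33].
by case: x y xy => [a ha] [b hb] /= ab; exact: eq_exist.
Qed.

Definition ord_seg (k : ordinal_type) (w : k) : ordinal_type :=
  @OrdinalType {v : k | ord_lt v w} (@seg_lt k w) (@seg_lt_wf k w)
    (@seg_lt_trans k w) (@seg_lt_total k w).

Definition homeomorphic (X Y : topologicalType) : Prop :=
  exists (f : X -> Y) (g : Y -> X),
    [/\ continuous f, continuous g, cancel f g & cancel g f].

Definition metrizable (R : realType) (X : topologicalType) : Prop :=
  exists M : metricType R, homeomorphic X M.

(* No connectedness is required.                                              *)
Definition continuum (R : realType) (X : topologicalType) : Prop :=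
  compact [set: X] /\ metrizable R X.

Definition sphere (R : realType) (n : nat) : set 'rV[R]_n.+1 :=
  [set x | \sum_i x 0 i ^+ 2 = 1].
Arguments sphere : clear implicits.

Definition Sn (R : realType) (n : nat) : topologicalType :=
  set_type (sphere R n).

Definition homotopic (R : realType) (X Y : topologicalType) (f g : X -> Y) :
    Prop :=
  exists H : R * X -> Y,
    [/\ {within `[0, 1] `*` [set: X], continuous H},
        forall x, H (0, x) = f x & forall x, H (1, x) = g x].

Definition null_homotopic (R : realType) (X Y : topologicalType) (f : X -> Y) :
    Prop :=
  exists y : Y, homotopic R f (cst y).

Definition maps_converge (S X : topologicalType) (f : nat -> S -> X) (x : X) :
    Prop :=
  forall U : set X, nbhs x U -> \forall k \near \oo, range (f k) `<=` U.

Definition fw (R : realType) (n : nat) (X : topologicalType) : set X :=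
  [set x | exists f : nat -> Sn R n -> X,
    [/\ forall k, continuous (f k),
        forall k, ~ null_homotopic R (f k) &
        maps_converge f x]].
Arguments fw : clear implicits.

(* [fw] of the subspace A of X, seen as a subset of X.                        *)
Definition fw_in (R : realType) (n : nat) (X : topologicalType) (A : set X) :
    set X :=
  set_val @` fw R n (set_type A).
Arguments fw_in R n {X} A.

Definition ord_covers (k : ordinal_type) (v w : k) : Prop :=
  ord_lt v w /\ forall u, ord_lt u w -> u = v \/ ord_lt u v.

(* An element w of k stands for the ordinal [ord_seg w], and [fw_stage w] is  *)
(* the iterate indexed by it. If w is the successor of some v, the step is    *)
(* fw of the iterate at v. Otherwise it is the intersection of all previous   *)
(* iterates, which is the whole space when w is least.                        *)
Definition fw_step (R : realType) (n : nat) (X : topologicalType)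
    (k : ordinal_type) (w : k) (rec : forall v : k, ord_lt v w -> set X) :
    set X :=
  [set x |
    (forall v (vw : ord_lt v w), ord_covers v w -> fw_in R n (rec v vw) x) /\
    (~ (exists v, ord_covers v w) ->
       forall v (vw : ord_lt v w), rec v vw x)].

Definition fw_stage (R : realType) (n : nat) (X : topologicalType)
    (k : ordinal_type) : k -> set X :=
  Fix (@ord_lt_wf k) (fun=> set X) (@fw_step R n X k).
Arguments fw_stage R n X {k} w.

(* The k-th iterate: k is the initial segment of k + 1 below its top element. *)
Definition fw_iter (R : realType) (n : nat) (X : topologicalType)
    (k : ordinal_type) : set X :=
  fw_stage R n X (None : ord_succ k).
Arguments fw_iter : clear implicits.

Definition fw_stable (R : realType) (n : nat) (X : topologicalType)
    (k : ordinal_type) : Prop :=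
  forall l, ord_le k l -> fw_iter R n X k = fw_iter R n X l.

(* k is the free pi_n-wild rank of X. Ordinals being well-ordered types, the  *)
(* rank is determined up to [ord_iso].                                        *)
Definition is_fwrk (R : realType) (n : nat) (X : topologicalType)
    (k : ordinal_type) : Prop :=
  fw_stable R n X k /\ forall l, fw_stable R n X l -> ord_le k l.
Arguments is_fwrk : clear implicits.

Definition countable_ordinal (k : ordinal_type) : Prop := countable [set: k].

Section recursion_equations.
Context (R : realType) (n : nat) (X : topologicalType).
Implicit Types k l : ordinal_type.

Lemma fw_stageE k (w : k) :
  fw_stage R n X w =
  fw_step R n (fun (v : k) (_ : ord_lt v w) => fw_stage R n X v).
Proof.
rewrite /fw_stage Fix_eq// => {}w f g fg.
have -> // : f = g.
by apply: functional_extensionality_dep => v; apply/funext.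
Qed.

Lemma ord_lt_irr k (w : k) : ~ ord_lt w w.
Proof.
by elim/(well_founded_ind (@ord_lt_wf k)): w => w IH ww; exact: (IH w).
Qed.

Lemma ord_covers_uniq k (u v w : k) :
  ord_covers u w -> ord_covers v w -> u = v.
Proof.
move=> [uw Hu] [vw Hv]; case: (Hv _ uw) => // uv.
case: (Hu _ vw) => // vu.
by case: (@ord_lt_irr k u); exact: ord_lt_trans uv vu.
Qed.

Lemma fw_stage_covers k (v w : k) : ord_covers v w ->
  fw_stage R n X w = fw_in R n (fw_stage R n X v).
Proof.
move=> vw; rewrite fw_stageE; apply/seteqP; split => x.
  by case=> + _; apply => //; case: vw.
move=> Hx; split; last by case; exists v.
by move=> u uw /ord_covers_uniq-/(_ _ vw) ->.
Qed.

Lemma fw_stage_lim k (w : k) : ~ (exists v, ord_covers v w) ->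
  fw_stage R n X w = \bigcap_(v in [set v | ord_lt v w]) fw_stage R n X v.
Proof.
move=> nw; rewrite fw_stageE; apply/seteqP; split => x.
  by case=> _ /(_ nw) H v /= vw; exact: H.
by move=> Hx; split => [v vw cvw|_ v vw]; [case: nw; exists v|exact: Hx].
Qed.

Lemma initial_embedding_inv k l (f : k -> l) : initial_embedding f ->
  forall x y, ord_lt (f x) (f y) -> ord_lt x y.
Proof.
move=> [fm _] x y fxy; case: (ord_lt_total x y) => // [xy|/fm fyx].
  by rewrite xy in fxy; case: (ord_lt_irr fxy).
by case: (@ord_lt_irr l (f x)); exact: ord_lt_trans fxy fyx.
Qed.

Lemma initial_embedding_inj k l (f : k -> l) :
  initial_embedding f -> injective f.
Proof.
move=> [fm _] x y fxy; case: (ord_lt_total x y) => // /fm; rewrite fxy;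
  by move/ord_lt_irr.
Qed.

Lemma fw_stage_embed k l (f : k -> l) : initial_embedding f ->
  forall w, fw_stage R n X (f w) = fw_stage R n X w.
Proof.
move=> fe w; elim/(well_founded_ind (@ord_lt_wf k)): w => w IH.
have [fm fi] := fe; have fr := initial_embedding_inv fe.
have fc v : ord_covers v w -> ord_covers (f v) (f w).
  move=> [vw Hv]; split; first exact: fm.
  move=> u ufw; have [y yu] := fi _ _ ufw; rewrite -yu in ufw *.
  by case: (Hv _ (fr _ _ ufw)) => [->|/fm]; [left|right].
have [[v cvw]|nw] := pselect (exists v, ord_covers v w).
  rewrite (fw_stage_covers cvw) (fw_stage_covers (fc _ cvw)) IH//.
  by case: cvw.
rewrite (fw_stage_lim nw) fw_stage_lim; last first.
  move=> [u [ufw Hu]]; have [v vu] := fi _ _ ufw; apply: nw; exists v.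
  rewrite -vu in ufw Hu; split; first exact: fr.
  move=> y /fm /Hu [/(initial_embedding_inj fe)|/fr]; first by left.
  by right.
apply/seteqP; split => x Hx v /= vw.
  by rewrite -IH//; apply: Hx; exact: fm.
by have [y yv] := fi _ _ vw; rewrite -yv in vw *; rewrite IH; [apply: Hx|];
  exact: fr.
Qed.

Lemma fw_iter_embed k l (w : l) (f : k -> l) : initial_embedding f ->
  (forall v, ord_lt v w <-> exists y, f y = v) ->
  fw_iter R n X k = fw_stage R n X w.
Proof.
move=> fe fw; have [fm fi] := fe.
pose g (x : ord_succ k) : l := if x is Some y then f y else w.
have ge : initial_embedding g.
  split=> [[x|] [y|] //=|[x|] z /=].
  - exact: fm.
  - by move=> _; apply/fw; exists x.
  - by move=> /fi[y <-]; exists (Some y).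
  - by move=> /fw[y <-]; exists (Some y).
by rewrite /fw_iter -(fw_stage_embed ge).
Qed.

Lemma fw_iter_seg k (w : k) : fw_iter R n X (ord_seg w) = fw_stage R n X w.
Proof.
apply: (@fw_iter_embed _ _ _ (fun x : ord_seg w => sval x)).
  split=> // -[x xw] z /= zx.
  by exists (exist _ z (ord_lt_trans zx xw)).
by move=> v; split=> [vw|[[y yw] <-]//]; exists (exist _ v vw).
Qed.

Lemma fw_iter_iso k l : ord_iso k l -> fw_iter R n X k = fw_iter R n X l.
Proof.
move=> [f [g [fg gf fm]]].
apply: (@fw_iter_embed _ (ord_succ l) _ (Some \o f)).
  split=> [x y /fm//|x [z|]//= _].
  by exists (g z); rewrite gf.
case=> [v|] /=; split=> //; first by exists (g v); rewrite gf.
by case.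
Qed.

Lemma fw_iter0 k : (k -> False) -> fw_iter R n X k = [set: X].
Proof.
move=> k0; rewrite /fw_iter fw_stage_lim; last by move=> [[v|]] [].
by apply/seteqP; split=> // x _ [v|].
Qed.

Lemma fw_iterS k :
  fw_iter R n X (ord_succ k) = fw_in R n (fw_iter R n X k).
Proof.
rewrite {1}/fw_iter (@fw_stage_covers (ord_succ (ord_succ k)) (Some None)); last first.
  by split=> // -[[u|]|] //= _; [right|left].
congr fw_in; rewrite /fw_iter.
apply: (@fw_stage_embed (ord_succ k) (ord_succ (ord_succ k)) Some).
by split=> // x [z|//] _; exists z.
Qed.

Lemma fw_iter_lim k : (forall x : k, exists y, ord_lt x y) ->
  fw_iter R n X k = \bigcap_(w in [set: k]) fw_iter R n X (ord_seg w).
Proof.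
move=> kl; have Some_e : @initial_embedding k (ord_succ k) Some.
  by split=> // x [z|//] _; exists z.
rewrite {1}/fw_iter fw_stage_lim; last first.
  move=> [[v|] [//= _ Hv]]; have [y vy] := kl v.
  case: (Hv (Some y) I) => [[yv]|/= yv].
    by rewrite yv in vy; exact: (ord_lt_irr vy).
  by apply: (@ord_lt_irr k v); exact: ord_lt_trans vy yv.
apply/seteqP; split => x Hx.
  move=> w _; rewrite fw_iter_seg -(fw_stage_embed Some_e).
  exact: Hx.
move=> [w|//] /= _; rewrite (fw_stage_embed Some_e) -fw_iter_seg.
exact: Hx.
Qed.

End recursion_equations.

(* Main.v *)
Require Import Defs.
From HB Require Import structures.
From mathcomp Require Import all_boot all_order all_algebra.
From mathcomp Require Import all_classical all_reals all_analysis.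
From mathcomp Require Import lra.

(** Write F for the operator sending a subspace A to the set of its free
    pi_n-wild points, so that the iterates are obtained by repeating F.

    Upper bound. In a first countable space a point is wild as soon as every
    neighbourhood of it receives an essential map, so F preserves closedness
    ([closed_fw_in]) and all iterates of a continuum are closed. The distinct
    iterates form a family that is closed under F and under intersections and
    is well-ordered by reverse inclusion ([tower_linear], [tower_max]); its
    order type below the least member is the rank. A strictly decreasing
    well-ordered family of closed sets is countable in a second countable
    space, since each of its members A meets some basic open set that avoids
    F A, hence avoids all later members ([rank_exists]).

    Realization. Put a unit sphere at height 0 in R^(n+1) x R, and above it
    infinitely many pairwise disjoint scaled copies of spaces of the same kind,
    with heights and diameters tending to 0 and with centers that accumulate at
    every point of the sphere. Unfolding this recipe along a relation
    child between types of pieces yields a compact set; the greatest fixed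
    point also contains the limits of infinite nestings, which is what makes
    the set closed ([closed_sphere_tree]). If P is the set of types that are
    still present, the tree keeps the same shape under F, with P replaced by
    the types of P that have a child in P ([fw_sphere_tree]): near a point of
    a sphere that has no pieces, small maps stay in an open hemisphere and are
    null-homotopic, whereas a sphere with pieces is approached everywhere by
    small copies of S^n. Those copies are essential because each piece, and
    each central sphere, is a retract of the whole space, and because the
    identity of S^n is not null-homotopic ([sphere_id_essential]).

    Thus the iterates of F on a tree reduce to combinatorics of types. For an
    ordinal l take as types the elements of l, each having the smaller ones as
    children, plus one more type, having all types including itself as
    children. The iterate of index w removes the types smaller than w
    ([fw_stage_ord_tree]). If l = m + 1 the tree grown from the type m has rank
    l, and its iterate of index m is a bare sphere; otherwise the tree grown
    from the additional type has rank l, and its last iterate is the tree built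
    from that type alone, which F leaves fixed.

    The fact that S^n is not contractible is derived from the theorem of
    Poincare and Miranda on zeros of maps of a cube, which follows by
    compactness from a statement on 0/1-labellings of a grid ([kuhn]). The
    latter comes from Stokes' formula for the cubical cup product of the
    coboundaries of the labels, with coefficients in the field with two
    elements. *)

Set Implicit Arguments.
Unset Strict Implicit.
Unset Printing Implicit Defensive.

Import Order.TTheory GRing.Theory Num.Theory.
Import numFieldTopology.Exports numFieldNormedType.Exports.

Local Open Scope classical_set_scope.
Local Open Scope ring_scope.

(** * Well-ordered types and the free wild rank *)

Lemma ord_min (k : ordinal_type) (P : set k) : P !=set0 ->
  exists2 x, P x & forall y, P y -> ~ ord_lt y x.
Proof.
move=> [x0 Px0]; apply: contrapT => noMin; move: x0 Px0.
elim/(well_founded_ind (@ord_lt_wf k)) => x IH Px; apply: noMin.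
by exists x => // y Py /IH; exact.
Qed.

Section comparison.
Context (k l : ordinal_type).

(** The relation saying that x and y have isomorphic initial segments, as the
    bisimulation between the two orders; it is a partial isomorphism, and
    comparing two ordinals amounts to finding out which side it exhausts. *)
Inductive order_match : k -> l -> Prop :=
| OrderMatch x y :
    (forall x', ord_lt x' x -> exists2 y', ord_lt y' y & order_match x' y') ->
    (forall y', ord_lt y' y -> exists2 x', ord_lt x' x & order_match x' y') ->
    order_match x y.

Lemma order_matchP x y : order_match x y ->
  (forall x', ord_lt x' x -> exists2 y', ord_lt y' y & order_match x' y') /\
  (forall y', ord_lt y' y -> exists2 x', ord_lt x' x & order_match x' y').
Proof. by case. Qed.

Lemma order_match_fun x y y' : order_match x y -> order_match x y' -> y = y'.
Proof.
elim/(well_founded_ind (@ord_lt_wf k)): x y y' => x IH.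
suff noLt y y' : order_match x y -> order_match x y' -> ~ ord_lt y y'.
  move=> y y' My My'.
  by case: (ord_lt_total y y') => // [/noLt|/noLt]; [case|case].
move=> /order_matchP[My _] /order_matchP[_ My'] /My'[x' x'x Mx'y].
have [y'' y''y Mx'y''] := My _ x'x.
by rewrite (IH _ x'x _ _ Mx'y Mx'y'') in y''y; exact: ord_lt_irr y''y.
Qed.

Lemma order_match_lt x y x' y' :
  order_match x y -> order_match x' y' -> ord_lt x x' -> ord_lt y y'.
Proof.
move=> Mxy /order_matchP[Mx' _] /Mx'[z zy' Mxz].
by rewrite (order_match_fun Mxy Mxz).
Qed.

End comparison.

(** Either the matching is defined on all of [k], or, at the least unmatched
    [w], it exhausts [l]: otherwise the least unmatched element of [l] would
    match [w]. *)
Lemma ord_le_total (k l : ordinal_type) :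
  ord_le k l \/ exists (w : k) (g : l -> k),
    initial_embedding g /\ (forall v, ord_lt v w <-> exists y, g y = v).
Proof.
have [total|] := pselect (forall x : k, exists y : l, order_match x y).
  left; have [f Mf] := choice total.
  exists f; split=> [x y|x z zfx]; first exact: order_match_lt.
  have [_ /(_ _ zfx)[x' _ Mx'z]] := order_matchP (Mf x).
  by exists x'; exact: order_match_fun Mx'z.
move=> /existsNP[w1 w1P]; right.
have [w w_unmatched w_min] :=
  @ord_min k [set x | ~ exists y : l, order_match x y] (ex_intro _ w1 w1P).
have below x : ord_lt x w -> exists y : l, order_match x y.
  by move=> xw; apply: contrapT => /w_min.
have onto (y : l) : exists2 x, ord_lt x w & order_match x y.
  apply: contrapT => y_missed.
  have [z z_missed z_min] := @ord_min l
    [set y | ~ exists2 x, ord_lt x w & order_match x y] (ex_intro _ y y_missed).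
  apply: w_unmatched; exists z; constructor=> [x xw|y' y'z].
    have [y' Mxy'] := below _ xw; exists y' => //.
    case: (ord_lt_total y' z) => // [y'z|zy'].
      by case: z_missed; exists x => //; rewrite -y'z.
    have [_ /(_ _ zy')[x' x'x Mx'z]] := order_matchP Mxy'.
    by case: z_missed; exists x' => //; exact: ord_lt_trans xw.
  by apply: contrapT => /z_min.
have onto' (y : l) : exists x, ord_lt x w /\ order_match x y.
  by have [x] := onto y; exists x.
have [g gP] := choice onto'.
have g_onto v : ord_lt v w -> exists2 y, g y = v & order_match v y.
  move=> vw; have [y Mvy] := below _ vw; exists y => //.
  have [_ Mgy] := gP y.
  case: (ord_lt_total (g y) v) => // [/(order_match_lt Mgy Mvy)|].
    by move/ord_lt_irr.
  by move=> /(order_match_lt Mvy Mgy) /ord_lt_irr.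
exists w, g; split; last first.
  move=> v; split=> [/g_onto[y]|[y <-]]; first by exists y.
  by case: (gP y).
split=> [x y xy|x z zgx].
  have [_ Mx] := gP x; have [_ My] := gP y.
  case: (ord_lt_total (g x) (g y)) => // [gxy|/(order_match_lt My Mx) yx].
    rewrite gxy in Mx; rewrite (order_match_fun Mx My) in xy.
    by case: (ord_lt_irr xy).
  by case: (@ord_lt_irr l x); exact: ord_lt_trans yx.
have [gxw _] := gP x.
by have [y <-] := g_onto _ (ord_lt_trans zgx gxw); exists y.
Qed.

Section rank_criterion.
Context (R : realType) (n : nat) (X : topologicalType).

Lemma fw_in_sub (A : set X) : fw_in R n A `<=` A.
Proof. by move=> _ [x _ <-]; exact: set_valP. Qed.

Lemma fw_stage_anti (k : ordinal_type) (v w : k) : ~ ord_lt w v ->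
  fw_stage R n X w `<=` fw_stage R n X v.
Proof.
elim/(well_founded_ind (@ord_lt_wf k)): w => w IH wv.
case: (ord_lt_total v w) => [vw|->//|//].
have [[u uw]|nw] := pselect (exists u, ord_covers u w).
  rewrite (fw_stage_covers _ _ _ uw); apply: subset_trans (@fw_in_sub _) _.
  case: uw => uw max_u; apply: IH => // u_v.
  case: (max_u _ vw) => [vu|vu]; first by rewrite vu in u_v; exact: ord_lt_irr u_v.
  by apply: (@ord_lt_irr k v); exact: ord_lt_trans u_v.
by rewrite fw_stage_lim// => x; exact.
Qed.

Lemma fw_stage_const (k : ordinal_type) (v w : k) :
  fw_in R n (fw_stage R n X v) = fw_stage R n X v -> ~ ord_lt w v ->
  fw_stage R n X w = fw_stage R n X v.
Proof.
move=> fixv; elim/(well_founded_ind (@ord_lt_wf k)): w => w IH wv.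
case: (ord_lt_total v w) => [vw|->//|//].
have [[u uw]|nw] := pselect (exists u, ord_covers u w).
  rewrite (fw_stage_covers _ _ _ uw) IH//; first by case: uw.
  move=> u_v; case: uw => _ /(_ _ vw)[vu|vu].
    by rewrite vu in u_v; exact: ord_lt_irr u_v.
  by apply: (@ord_lt_irr k v); exact: ord_lt_trans u_v.
apply/seteqP; split; first exact: fw_stage_anti.
rewrite (fw_stage_lim _ _ _ nw) => x vx u /= uw.
have [u_v|nuv] := pselect (ord_lt u v); last by rewrite IH.
apply: (fw_stage_anti _ vx) => vu.
by apply: (@ord_lt_irr k v); exact: ord_lt_trans u_v.
Qed.

Lemma fw_iter_image (k l : ordinal_type) (f : k -> l) : initial_embedding f ->
  (forall y, exists x, f x = y) -> fw_iter R n X k = fw_iter R n X l.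
Proof.
move=> fe f_onto; apply: (@fw_iter_embed _ _ _ _ (ord_succ l) None (Some \o f)).
  split=> [x y|x [z|//] /=]; first by case: fe => + _; apply.
  by case: fe => _ fi /fi[y <-]; exists y.
case=> [y|]; split=> //=; first by have [x <-] := f_onto y; exists x.
by case.
Qed.

(** When the image of [k] in [l] is proper, it is a segment below some [y], so
    that both iterates are stages of the same recursion, constant from [y] on. *)
Lemma fw_iter_fixed (k l : ordinal_type) :
  fw_in R n (fw_iter R n X k) = fw_iter R n X k -> ord_le k l ->
  fw_iter R n X k = fw_iter R n X l.
Proof.
move=> fixk [f fe].
have [f_onto|/existsNP[y0 y0P]] := pselect (forall y, exists x, f x = y).
  exact: fw_iter_image fe f_onto.
have [y y_missed y_min] := @ord_min l [set y | ~ exists x, f x = y]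
  (ex_intro _ y0 y0P).
have kE : fw_iter R n X k = fw_stage R n X (Some y : ord_succ l).
  rewrite (@fw_stage_embed _ _ _ l (ord_succ l) Some); last first.
    by split=> // a [b|//] ab; exists b.
  apply: (fw_iter_embed _ _ _ fe) => v; split.
    by move=> vy; apply: contrapT => /y_min.
  move=> [x fx]; case: (ord_lt_total v y) => // [vy|yv].
    by case: y_missed; exists x; rewrite -vy.
  have [_ fi] := fe; rewrite -fx in yv.
  by have := fi _ _ yv.
rewrite kE /fw_iter; rewrite kE in fixk.
by apply/esym/fw_stage_const.
Qed.

(** It suffices to look at the stages below [k]: an ordinal to which [k] does
    not embed is a segment of [k], and the iterate there is still moved. *)
Lemma is_fwrkP (k : ordinal_type) :
  (forall w : k, fw_in R n (fw_stage R n X w) <> fw_stage R n X w) ->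
  fw_in R n (fw_iter R n X k) = fw_iter R n X k ->
  is_fwrk R n X k.
Proof.
move=> moves fixk; split=> [l|l l_stable]; first exact: fw_iter_fixed.
have [//|[w [g [ge gw]]]] := ord_le_total k l.
case: (moves w); rewrite -(fw_iter_embed _ _ _ ge gw) -fw_iterS.
by apply/esym/l_stable; exists Some; split=> // x [z|//] _; exists z.
Qed.

End rank_criterion.

(** * The tower of iterates and its countable length *)

Section tower.
Context (T : Type) (F : set T -> set T).
Hypothesis F_sub : forall A, F A `<=` A.

(** The transfinite iterates of F without ordinals: by linearity, the least
    family closed under F and intersections is exactly the set of iterates. The
    empty intersection provides the whole space. *)
Inductive tower : set T -> Prop :=
| tower_step A : tower A -> tower (F A)
| tower_bigcap (D : set (set T)) :
    (forall A, D A -> tower A) -> tower (\bigcap_(A in D) A).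

(** Induction on both arguments. F is not monotone in general, so the inner
    induction compares [B] with [A] and [F A] at once; its outcome combines with
    the outer hypothesis because mutual inclusion is equality. *)
Lemma tower_linear A B : tower A -> tower B -> A `<=` F B \/ B `<=` A.
Proof.
move=> tA; elim: tA B => {A} [A tA IH|D tD IH] B tB; last first.
  have [[A DA AB]|none] := pselect (exists2 A, D A & A `<=` F B).
    by left=> x /(_ A DA) /AB.
  right=> x Bx A DA; case: (IH A DA B tB) => [AFB|]; last exact.
  by case: none; exists A.
have : A `<=` B \/ B `<=` F A.
  elim: tB => {B} [B tB [AB|BFA]|D tD IHD].
  - case: (IH B tB) => [|BA]; first by left.
    by right; rewrite (_ : A = B) //; apply/seteqP.
  - by right; exact: subset_trans (@F_sub _) BFA.
  - have [[B DB BFA]|none] := pselect (exists2 B, D B & B `<=` F A).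
      by right=> x /(_ B DB) /BFA.
    left=> x Ax B DB; case: (IHD B DB) => [|BFA]; first exact.
    by case: none; exists B.
case=> [AB|]; last by right.
case: (IH B tB) => [AFB|BA].
  by left; exact: subset_trans (@F_sub _) AFB.
by left; rewrite (_ : A = B) //; apply/seteqP.
Qed.

Lemma tower_fixed_least A B : tower A -> F A = A -> tower B -> A `<=` B.
Proof.
move=> tA FA; elim=> {B} [B tB AB|D tD AD].
  case: (tower_linear tA tB) => // BA.
  by rewrite (_ : B = A) ?FA//; apply/seteqP.
by move=> x Ax B DB; exact: AD.
Qed.

(** Let [U] be the intersection of the members of the tower that contain all of
    [D]. If [U] were not in [D], then [F U] would contain all of [D] as well, so
    that [U] would be a fixed point, hence the least member of the tower. *)
Lemma tower_max (D : set (set T)) : D `<=` tower -> D !=set0 ->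
  exists2 A, D A & forall B, D B -> B `<=` A.
Proof.
move=> tD [A0 DA0].
pose U := \bigcap_(A in [set A | tower A /\ forall B, D B -> B `<=` A]) A.
have tU : tower U by apply: tower_bigcap => A [].
have DU B : D B -> B `<=` U by move=> DB x Bx A [_ /(_ B DB)]; exact.
have [UD|nUD] := pselect (D U); first by exists U.
have DFU B : D B -> B `<=` F U.
  move=> DB; case: (tower_linear (tD _ DB) tU) => // UB.
  by case: nUD; rewrite (_ : U = B) //; apply/seteqP; split=> //; exact: DU.
have FU : F U = U.
  apply/seteqP; split=> // x; apply; split=> //; exact: tower_step.
by case: nUD; rewrite (_ : U = A0) //; apply/seteqP;
  split; [exact: tower_fixed_least (tD _ DA0)|exact: DU].
Qed.

Definition tower_sort := {A : set T | tower A}.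

Definition tower_lt (A B : tower_sort) := sval B `<` sval A.

Lemma tower_lt_wf : well_founded tower_lt.
Proof.
move=> A; apply: contrapT => nA.
pose D := [set sval B | B in [set B | ~ Acc tower_lt B]].
have tD : D `<=` tower by move=> _ [B _ <-]; case: B.
have D0 : D !=set0 by exists (sval A), A.
have [_ [B nB <-] maxB] := tower_max tD D0.
apply: nB; constructor=> C [BC nCB].
by apply: contrapT => nC; apply: nCB; apply: maxB; exists C.
Qed.

Lemma tower_lt_trans A B C : tower_lt A B -> tower_lt B C -> tower_lt A C.
Proof.
move=> [BA nAB] [CB nBC]; split; first exact: subset_trans CB BA.
by move=> subAC; apply: nAB; exact: subset_trans subAC CB.
Qed.

Lemma tower_lt_total A B : [\/ tower_lt A B, A = B | tower_lt B A].
Proof.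
case: A B => [A tA] [B tB].
have [AB|AB] := pselect (A = B); first by apply: Or32; exact: eq_exist.
have linAB : A `<=` B \/ B `<=` A.
  case: (tower_linear tA tB); last by right.
  by left; apply: subset_trans (@F_sub _).
case: linAB => [subAB|subBA].
  by apply: Or33; split=> //= BA; apply: AB; apply/seteqP.
by apply: Or31; split=> //= BA; apply: AB; apply/seteqP.
Qed.

Definition tower_ord : ordinal_type :=
  OrdinalType tower_lt_wf tower_lt_trans tower_lt_total.

Lemma tower_lt_sub (A B : tower_ord) : ord_lt A B -> sval B `<=` F (sval A).
Proof.
move=> [BA nAB].
by case: (tower_linear (svalP B) (svalP A)).
Qed.

Definition tower_bottom : tower_ord :=
  exist _ _ (@tower_bigcap tower (fun _ tA => tA)).

Lemma tower_bottomP : F (sval tower_bottom) = sval tower_bottom.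
Proof.
apply/seteqP; split=> // x; apply; apply: tower_step.
exact: (svalP tower_bottom).
Qed.

End tower.

Section rank_of_compact.
Context (R : realType) (n : nat) (X : topologicalType).

Let F := fw_in R n (X := X).
Let F_sub := @fw_in_sub R n X.

(** For the tower ordered by reverse inclusion, the recursion returns each
    member itself: between [B] and [F B] there is no further member. *)
Lemma fw_stage_tower (A : tower_ord F_sub) : fw_stage R n X A = sval A.
Proof.
elim/(well_founded_ind (@ord_lt_wf (tower_ord F_sub))): A => A IH.
have proper (B : tower_ord F_sub) : ord_lt B A -> F (sval B) <> sval B.
  move=> [AB nBA] FB; apply: nBA.
  exact: tower_fixed_least (svalP B) FB (svalP A).
have [[B [BA coverB]]|nA] := pselect (exists B, ord_covers B A).
  rewrite (fw_stage_covers _ _ _ (conj BA coverB)) IH//.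
  apply/seteqP; split; last exact: tower_lt_sub.
  pose FB : tower_ord F_sub := exist _ _ (tower_step (svalP B)).
  apply: contrapT => nFBA.
  have BFB : ord_lt B FB.
    by split; [exact: F_sub|move=> H; apply: (proper B) => //; apply/seteqP].
  have FBA : ord_lt FB A by split=> //; exact: tower_lt_sub.
  have [E|FBB] := coverB _ FBA.
    by rewrite E in BFB; exact: ord_lt_irr BFB.
  by apply: (@ord_lt_irr _ B); exact: ord_lt_trans FBB.
rewrite fw_stage_lim//; apply/seteqP; split=> [|x Ax B /= BA]; last first.
  by rewrite IH//; case: BA => + _; exact.
set U := \bigcap_(B in _) _.
have UE : U = \bigcap_(A' in [set sval B | B in [set B | ord_lt B A]]) A'.
  apply/seteqP; split=> [x Ux _ [B BA <-]|x Ux B BA].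
    by rewrite -IH//; exact: Ux.
  by rewrite IH//; apply: Ux; exists B.
have tU : tower F U.
  by rewrite UE; apply: tower_bigcap => _ [B _ <-]; exact: svalP.
have AU : sval A `<=` U.
  by rewrite UE => x Ax _ [B [AB _] <-]; exact: AB.
pose u : tower_ord F_sub := exist _ _ tU.
apply: contrapT => nUA; apply: nA; exists u.
have uA : ord_lt u A by [].
split=> // B BA; case: (ord_lt_total B u) => [|->|[BU nUB]].
- by right.
- by left.
case: nUB; rewrite /= UE => x Ux; apply: Ux.
by exists B.
Qed.

(** The rank is the segment of the tower above its least member. Each [A] there
    is strictly larger than the closed set [F A], so some basic open set meets
    [A] and misses [F A]; later members lie in [F A], whence injectivity of this
    choice. *)
Lemma rank_exists : @second_countable X ->
  (forall A : set X, closed A -> closed (F A)) ->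
  exists k : ordinal_type, countable_ordinal k /\ is_fwrk R n X k.
Proof.
move=> [base base_countable [_ baseP]] closedF.
pose b := tower_bottom F_sub.
have stageE (w : ord_seg b) : fw_stage R n X w = sval (sval w).
  rewrite -fw_stage_tower.
  rewrite -(@fw_stage_embed R n X (ord_seg b) _ sval)//.
  split=> // -[x xb] z /= zx.
  by exists (exist _ z (@ord_lt_trans (tower_ord F_sub) _ _ _ zx xb)).
have moves (w : ord_seg b) : F (sval (sval w)) <> sval (sval w).
  case: w => -[A tA] /= [bA nAb] FA; apply: nAb.
  by apply: tower_fixed_least FA _ => //; exact: svalP b.
have iterE : fw_iter R n X (ord_seg b) = sval b.
  by rewrite fw_iter_seg fw_stage_tower.
have closed_tower A : tower F A -> closed A.
  by elim=> [B _ /closedF//|D _ cD]; exact: closed_bigI.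
exists (ord_seg b); split; last first.
  apply: is_fwrkP => [w|]; first by rewrite stageE; exact: moves.
  by rewrite iterE; exact: tower_bottomP.
have sep (w : ord_seg b) : exists U, [/\ base U, U `&` sval (sval w) !=set0 &
    U `&` F (sval (sval w)) = set0].
  case: w (moves w) => -[A tA] /= _ moveA.
  have [x [Ax nFx]] : A `\` F A !=set0.
    apply/set0P/negP => /eqP; rewrite setD_eq0 => subF.
    by apply: moveA; apply/seteqP; split=> //; exact: F_sub.
  have : nbhs x (~` F A).
    apply: open_nbhs_nbhs; split=> //; apply: closed_openC.
    by apply: closedF; apply: closed_tower; exact: tA.
  move=> /(baseP x)[U [BU Ux] UF]; exists U; split=> //; first by exists x.
  by apply/seteqP; split=> // y [Uy Fy]; have := UF _ Uy.
have [c cP] := choice sep.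
have /countable_injP[code code_inj] := base_countable.
apply/countable_injP; exists (code \o c) => v w _ _ /= vw.
have {}vw : c v = c w.
  by apply: code_inj => //; rewrite inE; [case: (cP v)|case: (cP w)].
suff noLt v' w' : ord_lt v' w' -> c v' <> c w'.
  by case: (ord_lt_total v w) => [/noLt/(_ vw)|//|/noLt/(_ (esym vw))].
move=> {}vw cvw.
have [_ [x [Ux wx]] _] := cP w'; have [_ _ E] := cP v'.
suff : (c v' `&` F (sval (sval v'))) x by rewrite E.
by split; [rewrite cvw|exact: (@tower_lt_sub _ _ F_sub (sval v') (sval w'))].
Qed.

End rank_of_compact.

(** * A combinatorial form of the intermediate value theorem on a grid *)

Section cubical_cup_product.
Context (N : nat).
Local Notation I := 'I_N.
Local Notation grid := (I -> nat).
Local Notation F2 := 'F_2.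
Implicit Types (q x y : grid) (S : {set I}) (ls : seq (grid -> F2)).

Let addff (a : F2) : a + a = 0.
Proof. by apply: addrr_pchar2; exact: pchar_Fp. Qed.

Let oppf (a : F2) : - a = a.
Proof. by apply: oppr_pchar2; exact: pchar_Fp. Qed.

Definition grid_step q s : grid := fun i => (q i + (i == s))%N.

Lemma grid_stepC q s t : grid_step (grid_step q s) t = grid_step (grid_step q t) s.
Proof. by apply/funext => i; rewrite /grid_step addnAC. Qed.

(** The cup product of the coboundaries of the labels in [ls], evaluated on the
    cube at [q] spanned by the directions in [S]: the sum over all monotone edge
    paths through the cube of the products of the increments of the successive
    labels along the edges. A nonzero value forces every label to vary on the
    cube. *)
Fixpoint cup ls S q : F2 :=
  if ls is l :: ls' then
    \sum_(s in S) (l (grid_step q s) - l q) * cup ls' (S :\ s) (grid_step q s)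
  else 1.

Lemma exchange_pairs S (f : I -> I -> F2) :
  \sum_(s in S) \sum_(t in S :\ s) f s t = \sum_(s in S) \sum_(t in S :\ s) f t s.
Proof.
rewrite (exchange_big_dep (mem S)) /=; last by move=> s t _; rewrite !inE => /andP[].
apply: eq_bigr => t tS; apply: eq_bigl => s.
by rewrite !inE eq_sym tS andbT andbC.
Qed.

(** The terms (s, t) and (t, s) cancel in characteristic two. *)
Lemma sum_symmetric_pairs S (f : I -> I -> F2) : (forall s t, f s t = f t s) ->
  \sum_(s in S) \sum_(t in S :\ s) f s t = 0.
Proof.
move=> fC.
have split_lt s : \sum_(t in S :\ s) f s t =
    \sum_(t in S | (s < t)%N) f s t + \sum_(t in S | (t < s)%N) f s t.
  rewrite (bigID (fun t : I => (s < t)%N)) /=; congr (_ + _); apply: eq_bigl => t.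
    rewrite !inE; case: ltnP => st; rewrite ?andbF ?andbT//.
    by case: eqP st => // ->; rewrite ltnn.
  rewrite !inE -leqNgt ltn_neqAle andbC andbCA andbA andbC.
  by rewrite [val t == _]eq_sym -[val s == val t]/(s == t) eq_sym; case: (t == s).
under eq_bigr do rewrite split_lt.
rewrite big_split/= [X in _ + X](exchange_big_dep (mem S)) /=; last first.
  by move=> s t _ /andP[].
under [X in _ + X]eq_bigr => s sS.
  under eq_bigl => t do rewrite sS /=.
  under eq_bigr => t _ do rewrite fC.
  over.
by rewrite addff.
Qed.

Lemma setD1C S s t : S :\ s :\ t = S :\ t :\ s.
Proof. by rewrite !finset.setDDl finset.setUC. Qed.

(** A cup product of coboundaries is a cocycle. In the double sum over ordered
    pairs of directions, the terms that depend only on the far corner, or only on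
    the near corner, are symmetric and cancel; the induction hypothesis moves the
    remaining factor from the near to the far face. *)
Lemma cup_closed ls S q :
  \sum_(s in S) cup ls (S :\ s) (grid_step q s) =
  \sum_(s in S) cup ls (S :\ s) q.
Proof.
elim: ls S q => [//|l ls IH] S q /=.
pose W s t := cup ls (S :\ s :\ t) (grid_step (grid_step q s) t).
have WC s t : W s t = W t s by rewrite /W setD1C grid_stepC.
transitivity (\sum_(s in S) \sum_(t in S :\ s) l (grid_step q s) * W s t).
  under eq_bigr do under eq_bigr do rewrite mulrBl oppf.
  under eq_bigr do rewrite big_split/=.
  rewrite big_split/= sum_symmetric_pairs ?add0r//.
  by move=> s t; rewrite -/(W s t) -/(W t s) WC grid_stepC.
rewrite [RHS]exchange_pairs.
transitivity (\sum_(s in S) (l (grid_step q s) - l q) * \sum_(t in S :\ s) W s t).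
  under eq_bigr do rewrite -mulr_sumr.
  under [RHS]eq_bigr do rewrite mulrBl.
  rewrite sumrB; apply/eqP; rewrite addrC -subr_eq subrr oppf -mulr_sumr.
  by rewrite sum_symmetric_pairs ?mulr0.
apply: eq_bigr => s _; rewrite /W IH mulr_sumr.
by apply: eq_bigr => t _; rewrite setD1C.
Qed.

(** The product of the coboundary of [l] with a cocycle is the coboundary of
    [l] times that cocycle. *)
Lemma cup_stokes l ls S q : cup (l :: ls) S q =
  \sum_(s in S) (l (grid_step q s) * cup ls (S :\ s) (grid_step q s)
                 - l q * cup ls (S :\ s) q).
Proof.
rewrite /= sumrB -mulr_sumr -cup_closed mulr_sumr -sumrB.
by apply: eq_bigr => s _; rewrite mulrBl.
Qed.

(** No edge path in the directions [S] changes the coordinate [t]. *)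
Lemma cup_constant ls S q l t c : l \in ls -> t \notin S ->
  (forall y, y t = q t -> l y = c) -> cup ls S q = 0.
Proof.
elim: ls S q => [//|l' ls IH] S q /=; rewrite in_cons => l_in tS lc.
rewrite big1// => s sS.
have st : grid_step q s t = q t.
  rewrite /grid_step; case: eqP => [E|_]; last by rewrite addn0.
  by rewrite E sS in tS.
move: l_in; case: eqP => [<- _|_ /= l_in]; first by rewrite !lc// subrr mul0r.
by rewrite (IH _ _ l_in) ?mulr0// ?inE ?negb_and ?tS ?orbT// => y; rewrite st; exact: lc.
Qed.

Lemma cup_changes ls S q l : l \in ls -> cup ls S q != 0 ->
  exists a b, [/\ forall i, (q i <= a i <= (q i).+1)%N,
                  forall i, (q i <= b i <= (q i).+1)%N & l a != l b].
Proof.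
move=> l_in cup_neq0.
(* In the induction the set of available directions shrinks. *)
suff [a [b [qa qb ab]]] : exists a b,
    [/\ forall i, (q i <= a i <= q i + (i \in S))%N,
        forall i, (q i <= b i <= q i + (i \in S))%N & l a != l b].
  exists a, b; split=> // i; [have /andP[-> ai] := qa i|have /andP[-> ai] := qb i];
    by apply: leq_trans ai _; rewrite -addn1 leq_add2l leq_b1.
elim: ls S q l_in cup_neq0 => [//|l' ls IH] S q l_in /=.
move=> /eqP sum_neq0.
have [s sS] : exists2 s, s \in S &
    (l' (grid_step q s) - l' q) * cup ls (S :\ s) (grid_step q s) != 0.
  apply: contrapT => H; apply: sum_neq0; rewrite big1// => s sS.
  by apply/eqP/negPn/negP => ?; apply: H; exists s.
rewrite mulf_eq0 negb_or subr_eq0 => /andP[l'_neq W_neq0].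
have step_le i : (grid_step q s i <= q i + (i \in S))%N.
  by rewrite /grid_step leq_add2l; case: eqP => // ->; rewrite sS.
move: l_in; rewrite in_cons; case: eqP => [-> _|_ /= l_in].
  exists (grid_step q s), q; split=> // i; last by rewrite leqnn leq_addr.
  by rewrite step_le andbT /grid_step leq_addr.
have [a [b [sa sb ab]]] := IH _ _ l_in W_neq0.
have bound c : (forall i, grid_step q s i <= c i <= grid_step q s i + (i \in S :\ s))%N ->
    forall i, (q i <= c i <= q i + (i \in S))%N.
  move=> sc i; have /andP[ge_c le_c] := sc i; apply/andP; split.
    by apply: leq_trans ge_c; rewrite leq_addr.
  apply: leq_trans le_c _; rewrite /grid_step -addnA leq_add2l !inE.
  by case: eqP => [->|_] /=; rewrite ?sS.
by exists a, b; split=> //; exact: bound.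
Qed.

Definition grid_set q i k : grid := fun j => if j == i then k else q j.

Lemma grid_setC q i j k m : i != j ->
  grid_set (grid_set q i k) j m = grid_set (grid_set q j m) i k.
Proof.
move=> ij; apply/funext => a; rewrite /grid_set.
by case: eqP => // ->; rewrite eq_sym (negbTE ij).
Qed.

Lemma grid_set_step q i k : grid_step (grid_set q i k) i = grid_set q i k.+1.
Proof.
apply/funext => j; rewrite /grid_step /grid_set.
by case: eqP; rewrite ?addn1 ?addn0.
Qed.

Variable p : nat.

Fixpoint box_sum (s : seq I) (f : grid -> F2) q : F2 :=
  if s is i :: s' then \sum_(k < p) box_sum s' f (grid_set q i k) else f q.

Lemma box_sum_rem s f q i : uniq s -> i \in s ->
  box_sum s f q = box_sum (i :: rem i s) f q.
Proof.
elim: s q => [//|j s IH] q /= /andP[js us].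
rewrite in_cons (eq_sym i j); case: (eqVneq j i) => [->//|ji] /= i_s.
under eq_bigr do rewrite IH//=.
rewrite exchange_big/=; apply: eq_bigr => k _; apply: eq_bigr => m _.
by rewrite grid_setC.
Qed.

Lemma box_sum_inner s f q i : i \notin s ->
  box_sum (i :: s) f q = box_sum s (fun q => \sum_(k < p) f (grid_set q i k)) q.
Proof.
elim: s q => [//|j s IH] q; rewrite in_cons negb_or => /andP[ij i_s] /=.
rewrite exchange_big/=; apply: eq_bigr => k _; rewrite -IH//=.
by apply: eq_bigr => m _; rewrite grid_setC.
Qed.

Lemma eq_box_sum s f g q : (forall x, f x = g x) -> box_sum s f q = box_sum s g q.
Proof. by move=> /funext ->. Qed.

Lemma box_sum_sum s (J : finType) (A : {set J}) (f : J -> grid -> F2) q :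
  box_sum s (fun x => \sum_(t in A) f t x) q = \sum_(t in A) box_sum s (f t) q.
Proof.
elim: s q => [//|i s IH] q /=; rewrite exchange_big/=.
by apply: eq_bigr => k _; rewrite IH.
Qed.

Lemma box_sum0 s q : box_sum s (fun=> 0) q = 0.
Proof. by elim: s q => [//|i s IH] q /=; rewrite big1. Qed.

Lemma box_sum_telescope s f q i : uniq s -> i \in s ->
  box_sum s (fun x => f (grid_step x i) - f x) q =
  box_sum (rem i s) (fun x => f (grid_set x i p) - f (grid_set x i 0)) q.
Proof.
move=> us i_s; rewrite (box_sum_rem _ _ us i_s) box_sum_inner; last first.
  by rewrite mem_rem_uniq// !inE eqxx.
apply: eq_box_sum => x; under eq_bigr do rewrite grid_set_step.
rewrite -(big_mkord xpredT (fun k => f (grid_set x i k.+1) - f (grid_set x i k))).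
by rewrite (telescope_sumr (fun k => f (grid_set x i k))).
Qed.

Lemma box_sum_set s f q i k : i \notin s ->
  box_sum s (fun x => f (grid_set x i k)) q = box_sum s f (grid_set q i k).
Proof.
elim: s q => [//|j s IH] q; rewrite in_cons negb_or => /andP[ij i_s] /=.
by apply: eq_bigr => m _; rewrite IH// grid_setC 1?eq_sym.
Qed.

Lemma box_sum_neq0 s f q : box_sum s f q != 0 -> exists x, f x != 0 /\
  forall i, i \in s -> uniq s -> (x i < p)%N.
Proof.
suff H : box_sum s f q != 0 -> exists x, [/\ f x != 0,
    forall i, i \in s -> uniq s -> (x i < p)%N & forall i, i \notin s -> x i = q i].
  by move=> /H[x [? ? _]]; exists x.
elim: s q => [|i s IH] q /=; first by move=> fq; exists q.
move=> /eqP sum_neq0.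
have [k] : exists k : 'I_p, box_sum s f (grid_set q i k) != 0.
  apply: contrapT => H; apply: sum_neq0; rewrite big1// => k _.
  by apply/eqP/negPn/negP => ?; apply: H; exists k.
move=> /IH[x [fx x_in x_out]]; exists x; split=> // j; rewrite in_cons.
  case: eqP => [-> _ /andP[i_s _]|_ /= j_s /andP[_ /x_in]]; last exact.
  by rewrite x_out// /grid_set eqxx.
by rewrite negb_or => /andP[ji /x_out ->]; rewrite /grid_set (negbTE ji).
Qed.

(** By Stokes' formula the sum reduces to the faces of the box. On the two faces
    orthogonal to a later direction [t] the label of [t] is constant and kills
    the product; of the two faces orthogonal to [i], the first label keeps only
    the upper one, where the sum is that of the remaining labels. *)
Lemma box_sum_cup (l : I -> grid -> F2) s q :
  (forall i x, x i = 0%N -> l i x = 0) -> (forall i x, x i = p -> l i x = 1) ->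
  uniq s -> box_sum s (cup [seq l i | i <- s] [set x in s]) q = 1.
Proof.
move=> l0 l1; elim: s q => [//|i s IH] q us.
have [i_s us'] : i \notin s /\ uniq s by apply/andP.
rewrite (eq_box_sum _ _ (cup_stokes _ _ _)) box_sum_sum.
have set_s : [set x in i :: s] :\ i = [set x in s].
  apply/setP => j; rewrite !inE; case: eqP => //= ->.
  by rewrite (negbTE i_s).
pose g t x := l i x * cup [seq l j | j <- s] ([set x in i :: s] :\ t) x.
transitivity (\sum_(t in [set x in i :: s])
    box_sum (i :: s) (fun x => g t (grid_step x t) - g t x) q); first by [].
rewrite (bigD1 i) ?inE ?eqxx//.
rewrite (box_sum_telescope (g i))//; last by rewrite mem_head.
rewrite (_ : rem i (i :: s) = s); last by rewrite /= eqxx.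
rewrite (@eq_box_sum s _ (fun x => cup [seq l j | j <- s] [set x in s] (grid_set x i p))); last first.
  move=> x; rewrite /g set_s l1 ?mul1r; last by rewrite /grid_set eqxx.
  by rewrite l0 ?mul0r ?subr0// /grid_set eqxx.
rewrite box_sum_set// IH// big1 ?Monoid.mulm1// => t /andP[]; rewrite inE => t_in ti.
have t_s : t \in s by move: t_in; rewrite in_cons (negbTE ti).
rewrite (box_sum_telescope (g t))//.
have lt_in : l t \in [seq l j | j <- s] by exact: map_f.
rewrite (@eq_box_sum _ _ (fun=> 0)) ?box_sum0// => x; rewrite /g.
rewrite (cup_constant (t := t) (c := 1) lt_in) ?(cup_constant (t := t) (c := 0) lt_in).
- by rewrite !mulr0 subrr.
- by rewrite !inE eqxx.
- by move=> y; rewrite /grid_set eqxx; exact: l0.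
- by rewrite !inE eqxx.
- by move=> y; rewrite /grid_set eqxx; exact: l1.
Qed.

(** The cup product of all labels sums to 1 over the box, so it is nonzero on
    some cube. *)
Lemma kuhn (l : I -> grid -> bool) :
  (forall i x, x i = 0%N -> ~~ l i x) -> (forall i x, x i = p -> l i x) ->
  exists q, (forall i, (q i < p)%N) /\ forall i, exists a b,
    [/\ forall j, (q j <= a j <= (q j).+1)%N,
        forall j, (q j <= b j <= (q j).+1)%N, l i a & ~~ l i b].
Proof.
move=> l0 l1; pose L i x : F2 := (l i x)%:R.
have L0 i x : x i = 0%N -> L i x = 0 by move=> /l0; rewrite /L => /negbTE ->.
have L1 i x : x i = p -> L i x = 1 by move=> /l1; rewrite /L => ->.
have box1 := box_sum_cup (fun=> 0%N) L0 L1 (enum_uniq I).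
have /box_sum_neq0[q [cup_neq0 qp]] := etrans (congr1 (fun z => z != 0) box1)
  (oner_neq0 _).
exists q; split=> [i|i]; first by rewrite qp ?enum_uniq ?mem_enum.
have L_in : L i \in [seq L i | i <- enum I] by apply: map_f; rewrite mem_enum.
have [a [b [qa qb]]] := cup_changes L_in cup_neq0.
rewrite /L; case ai: (l i a); case bi: (l i b); rewrite ?eqxx// => _.
  by exists a, b; rewrite ai bi.
by exists b, a; rewrite ai bi.
Qed.

End cubical_cup_product.

(** * Continuity and normalization of vectors *)

(** Continuity of a homotopy on the cylinder over the unit interval is used
    through maps that take values in this cylinder. *)
Lemma continuous_within_comp (T U V : topologicalType) (A : set U) (g : U -> V)
    (f : T -> U) (x : T) :
  {within A, continuous g} -> {for x, continuous f} -> (forall y, A (f y)) ->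
  {for x, continuous (g \o f)}.
Proof.
move=> /subspace_continuousP cg cf Af; have := cg (f x) (Af x) => cgx W /cgx.
rewrite nbhs_simpl /within /= => gW.
have : \forall y \near x, A (f y) -> W (g (f y)) by exact: cf gW.
by apply: filterS => y; apply; exact: Af.
Qed.

Lemma near_eq_continuous (T U : topologicalType) (f g : T -> U) (x : T) :
  (\forall y \near x, f y = g y) -> {for x, continuous f} -> {for x, continuous g}.
Proof.
move=> fg cf; have fgx : f x = g x by exact: nbhs_singleton fg.
move=> W gW; have fW : \forall y \near x, W (f y) by apply: cf; rewrite fgx.
have : \forall y \near x, W (g y) by apply: filterS2 fg fW => y ->.
exact.
Qed.

Lemma pair_continuous (T U V : topologicalType) (f : T -> U) (g : T -> V) (x : T) :
  {for x, continuous f} -> {for x, continuous g} ->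
  {for x, continuous (fun y => (f y, g y))}.
Proof.
move=> cf cg W [[A B] /= [nA nB] AB].
have fA : \forall y \near x, A (f y) by exact: cf.
have gB : \forall y \near x, B (g y) by exact: cg.
have : \forall y \near x, W (f y, g y).
  by apply: filterS2 fA gB => y fy gy; apply: AB.
exact.
Qed.

Lemma fst_continuous (T U : topologicalType) : continuous (@fst T U).
Proof. by move=> x; exact: cvg_fst. Qed.

Lemma snd_continuous (T U : topologicalType) : continuous (@snd T U).
Proof. by move=> x; exact: cvg_snd. Qed.

Lemma subtype_continuous (T U : topologicalType) (A : set U)
    (f : T -> set_type A) (x : T) :
  {for x, continuous (set_val \o f : T -> U)} -> {for x, continuous f}.
Proof.
move=> cf W [_ /= [[B oB <-] /= Bfx BW]].
by apply: filterS (BW : _ `<=` _) _; apply: cf; exact: open_nbhs_nbhs.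
Qed.

Lemma set_val_inj (T : Type) (A : set T) : injective (set_val : set_type A -> T).
Proof. by move=> x y xy; apply: val_inj. Qed.

Lemma set_val_continuous (U : topologicalType) (A : set U) :
  continuous (set_val : set_type A -> U).
Proof. exact: initial_continuous. Qed.

Section euclidean_sphere.
Context (R : realType) (n : nat).
Local Notation V := 'rV[R]_n.+1.
Implicit Types x y : V.

Definition sqnorm x : R := \sum_i x 0 i ^+ 2.

Lemma sqnorm_continuous : continuous sqnorm.
Proof.
apply: (@continuous_big R^o) => [|i _]; first exact: add_continuous.
move=> x; apply: (@continuous_comp V R R (fun x : V => x 0 i) (fun a => a ^+ 2)).
  exact: coord_continuous.
exact: exprn_continuous.
Qed.

Lemma sqnorm_ge0 x : 0 <= sqnorm x.
Proof. by apply: sumr_ge0 => i _; exact: sqr_ge0. Qed.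

Lemma sqnorm_eq0 x : (sqnorm x == 0) = (x == 0).
Proof.
apply/idP/eqP => [|->]; last by rewrite /sqnorm big1// => i _; rewrite mxE expr0n.
rewrite psumr_eq0; last by move=> i _; exact: sqr_ge0.
move=> /allP x0; apply/rowP => i; rewrite mxE.
by have := x0 i (mem_index_enum i); rewrite sqrf_eq0 => /eqP.
Qed.

Lemma sqnormZ (c : R) x : sqnorm (c *: x) = c ^+ 2 * sqnorm x.
Proof. by rewrite /sqnorm mulr_sumr; apply: eq_bigr => i _; rewrite mxE exprMn. Qed.

Lemma coord_le_norm x i : `|x 0 i| <= `|x|.
Proof.
rewrite [leRHS]/Num.norm /= mx_normrE.
by apply/bigmax_geP; right => /=; exists (0, i).
Qed.

Lemma norm_le_coord x (c : R) : 0 <= c -> (forall i, `|x 0 i| <= c) -> `|x| <= c.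
Proof.
move=> c0 xc; rewrite [leLHS]/Num.norm /= mx_normrE.
by apply/bigmax_leP; split=> // -[i j] _ /=; rewrite (ord1 i).
Qed.

(** The radial projection to the unit sphere, with an arbitrary value at the
    origin. *)
Definition normalize x : V :=
  if x == 0 then delta_mx 0 0 else (Num.sqrt (sqnorm x))^-1 *: x.

Lemma normalize_sphere x : sphere R n (normalize x).
Proof.
rewrite /sphere /= -/(sqnorm _) /normalize; case: ifPn => x0.
  rewrite /sqnorm (bigD1 0)//= mxE !eqxx expr1n big1 ?addr0// => i i0.
  by rewrite mxE eqxx (negbTE i0) expr0n.
rewrite sqnormZ exprVn sqr_sqrtr ?sqnorm_ge0// mulVf//.
by rewrite sqnorm_eq0.
Qed.

Lemma normalize_id x : sphere R n x -> normalize x = x.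
Proof.
rewrite /sphere /= -/(sqnorm _) /normalize => x1; case: ifPn => [x0|_].
  by move: x0; rewrite -sqnorm_eq0 x1 oner_eq0.
by rewrite x1 sqrtr1 invr1 scale1r.
Qed.

Lemma normalize_continuous x : x != 0 -> {for x, continuous normalize}.
Proof.
move=> x0; have cv : {for x, continuous (fun y => (Num.sqrt (sqnorm y))^-1 *: y)}.
  apply: continuousZ => //.
  apply: continuousV; first by rewrite sqrtr_eq0 -ltNge lt0r sqnorm_eq0 x0 sqnorm_ge0.
  apply: continuous_comp; [exact: sqnorm_continuous|exact: sqrt_continuous].
apply: near_eq_continuous cv.
have : \forall a \near sqnorm x, a != 0.
  by apply: open_nbhs_nbhs; split; [exact: open_neq|rewrite /= sqnorm_eq0].
move=> /sqnorm_continuous near_sq.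
have near_x : \forall y \near x, sqnorm y != 0 by exact: near_sq.
by apply: filterS near_x => y; rewrite sqnorm_eq0 /normalize => /negbTE ->.
Qed.

Definition to_sphere x : Sn R n := exist _ (normalize x) (mem_set (normalize_sphere x)).

Lemma sphere_val (s : Sn R n) : sphere R n (set_val s).
Proof. exact: set_valP. Qed.

Lemma to_sphereK (s : Sn R n) : to_sphere (set_val s) = s.
Proof. by apply/val_inj; rewrite /= normalize_id//; exact: sphere_val. Qed.

Lemma to_sphere_continuous x : x != 0 -> {for x, continuous to_sphere}.
Proof. by move=> x0; apply: subtype_continuous; exact: normalize_continuous. Qed.

End euclidean_sphere.

(** * The identity of the sphere is essential *)

Section miranda.
Context (R : realType) (n : nat).
Local Notation V := 'rV[R]_n.+1.

Let mesh (k : nat) : R := 2 / k.+1%:R.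

Lemma mesh_small (e : R) : 0 < e -> \forall k \near \oo, mesh k < e.
Proof.
move=> e0; have e20 : 0 < e / 2 by rewrite divr_gt0.
apply: filterS (near_infty_natSinv_lt (PosNum e20)) => k /=.
by rewrite /mesh ltr_pdivlMr// mulrC.
Qed.

(** Label the points of a grid by the signs of the coordinates of [G]. Finer and
    finer grids give small cubes on which all coordinates change sign; these
    cubes accumulate at a zero. *)
Theorem poincare_miranda (G : V -> V) : continuous G ->
  (forall (x : V) i, x 0 i = -1 -> G x 0 i <= 0) ->
  (forall (x : V) i, x 0 i = 1 -> 0 < G x 0 i) -> exists x, G x = 0.
Proof.
move=> cG Gneg Gpos.
have sign_changes k : exists z : V, (forall i, -1 <= z 0 i <= 1) /\
    forall i, exists a b, [/\ `|z - a| <= mesh k, `|z - b| <= mesh k,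
      0 < G a 0 i & G b 0 i <= 0].
  have k0 : 0 < k.+1%:R :> R by rewrite ltr0n.
  (* The grid of mesh 2/(k+1) on the cube of side 2. *)
  pose pt (q : 'I_n.+1 -> nat) : V := \row_i (mesh k * (q i)%:R - 1).
  have [|i q qi|q [q_le qP]] := @kuhn n.+1 k.+1 (fun i q => 0 < G (pt q) 0 i).
  - by move=> i q qi; rewrite -leNgt; apply: Gneg; rewrite mxE qi mulr0 sub0r.
  - apply: Gpos; rewrite mxE qi /mesh mulfVK ?gt_eqF//.
    by rewrite -[2]/(1 + 1) addrK.
  exists (pt q); split=> [i|i].
    rewrite mxE lerBrDr addNr mulr_ge0 ?divr_ge0 ?ler0n//=.
    rewrite lerBlDr -[1 + 1]/(2%:R : R) /mesh mulrAC ler_pdivrMr//.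
    by rewrite ler_pM2l// ler_nat ltnW.
  have [a [b [qa qb Ga Gb]]] := qP i.
  have close c : (forall j, (q j <= c j <= (q j).+1)%N) -> `|pt q - pt c| <= mesh k.
    move=> qc; apply: norm_le_coord => [|j]; first by rewrite /mesh divr_ge0 ?ler0n.
    rewrite !mxE opprB addrA subrK -mulrBr normrM ger0_norm ?divr_ge0 ?ler0n//.
    rewrite ler_piMr ?divr_ge0 ?ler0n// distrC.
    have /andP[qcj] := qc j; rewrite -natrB// ger0_norm ?ler0n// => cqj.
    by rewrite lern1 leq_subLR addn1.
  by exists (pt a), (pt b); split=> //; rewrite ?close// leNgt.
have [z zP] := choice sign_changes.
have cube_compact : compact [set x : V | forall i, `[-1, 1]%classic (x 0 i)].
  by apply: (@rV_compact R^o _ (fun=> `[-1, 1]%classic)) => _; exact: segment_compact.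
have [|x [_ x_cluster]] := cube_compact (z @ \oo) _.
  exists 0%N => // k _ i; have [/(_ i)] := zP k.
  by rewrite /= in_itv.
have near_x (U : set V) : nbhs x U -> exists k,
    forall y, `|z k - y| <= mesh k -> U y.
  move=> /nbhs_ballP[e /= e0 eU].
  have e2 : 0 < e / 2 by rewrite divr_gt0.
  have [K _ meshK] := mesh_small e2.
  have zK : (z @ \oo) [set z k | k in [set k | (K <= k)%N]].
    by exists K => // k /= Kk; exists k.
  have [_ [[k Kk <-]]] := x_cluster _ _ zK (nbhsx_ballx x _ e2).
  rewrite -ball_normE /= => xz; exists k => y zy; apply: eU.
  rewrite -ball_normE /= -(subrK (z k) x) -addrA.
  apply: le_lt_trans (ler_normD _ _) _; rewrite (splitr e) ltrD//.
  by apply: le_lt_trans zy _; exact: meshK.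
exists x; apply/rowP => i; rewrite mxE.
have cGi : {for x, continuous (fun y : V => G y 0 i)}.
  by apply: (@continuous_comp _ _ _ G (fun y : V => y 0 i)); [exact: cG|exact: coord_continuous].
case: (ltrgtP (G x 0 i) 0) => // [Gx|Gx].
  have /near_x[k kP] : nbhs x [set y | G y 0 i < 0].
    by apply: (cGi [set a | a < 0]); apply: open_nbhs_nbhs; split; [exact: open_lt|].
  have [_ /(_ i)[a [_ [za _ Ga _]]]] := zP k.
  by have := kP _ za; rewrite /= ltNge (ltW Ga).
have /near_x[k kP] : nbhs x [set y | 0 < G y 0 i].
  by apply: (cGi [set a | 0 < a]); apply: open_nbhs_nbhs; split; [exact: open_gt|].
have [_ /(_ i)[_ [b [_ zb _ Gb]]]] := zP k.
by have := kP _ zb; rewrite /= ltNge Gb.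
Qed.

End miranda.

Lemma null_homotopic_comp (R : realType) (X Y Z : topologicalType)
    (f : X -> Y) (g : Y -> Z) :
  continuous g -> null_homotopic R f -> null_homotopic R (g \o f).
Proof.
move=> cg [y [H [cH H0 H1]]]; exists (g y), (g \o H); split=> [|x|x] /=.
- by apply: within_continuous_comp => // z _; exact: cg.
- by rewrite H0.
- by rewrite H1.
Qed.

Section sphere_essential.
Context (R : realType) (n : nat).
Local Notation V := 'rV[R]_n.+1.

(** A contraction of the sphere, run along the radii of a cube and stopped at
    distance 1/2 of the center, gives a map [G] from the cube to the sphere that
    coincides with the radial projection outside the cube. Such a map satisfies
    the sign conditions of [poincare_miranda], yet has no zero. *)
Theorem sphere_id_essential : ~ null_homotopic R (@id (Sn R n)).
Proof.
move=> [s [H [cH H0 H1]]].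
(* The time of the homotopy at a point of norm t: 0 from t = 1 on, and 1
   up to t = 1/2. *)
pose time (x : V) : R := Order.min 1 (Order.max 0 (2 - 2 * `|x|)).
have time01 x : 0 <= time x <= 1.
  by rewrite /time le_min ge_min ler01 lexx le_max lexx.
have time_continuous : continuous time.
  move=> x; apply: (@continuous_min R V (cst 1)); first exact: cst_continuous.
  apply: (@continuous_max R V (cst 0)); first exact: cst_continuous.
  apply: (@continuousB R R^o V (cst 2)); first exact: cst_continuous.
  apply: (@continuousM R V (cst 2)); first exact: cst_continuous.
  exact: norm_continuous.
pose G (x : V) : V := set_val (H (time x, to_sphere x)).
have cG : continuous G.
  move=> x; apply: (@continuous_comp V (Sn R n) V); last exact: set_val_continuous.
  have [->|x0] := eqVneq x 0; last first.
    apply: (@continuous_within_comp V _ _ _ H (fun x => (time x, to_sphere x))) => //.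
      apply: pair_continuous; [exact: time_continuous|exact: to_sphere_continuous].
    by move=> y; split=> //=; rewrite in_itv /=; exact: time01.
  have : {for (0 : V), continuous (fun _ : V => s)} by exact: cst_continuous.
  apply: near_eq_continuous; apply/nbhs_ballP; exists (2^-1) => /=; first by rewrite invr_gt0.
  move=> y; rewrite -ball_normE /= sub0r normrN => y_small.
  rewrite (_ : time y = 1) ?H1// /time max_r.
    apply: min_l; rewrite lerBrDr -lerBrDl (_ : 2 - 1 = 1 :> R).
      by rewrite -ler_pdivlMl// mulr1 ltW.
    by rewrite -[2]/(1 + 1) addrK.
  rewrite subr_ge0 ger_pMr//; apply: ltW; apply: lt_trans y_small _.
  by rewrite invf_lt1 ?ltr1n.
have G_out (x : V) i : 1 <= `|x 0 i| ->
    exists2 c : R, 0 < c & G x 0 i = c * x 0 i.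
  move=> xi; have x_big : 1 <= `|x| by apply: le_trans xi (coord_le_norm _ _).
  have x0 : x != 0 by rewrite -normr_gt0; exact: lt_le_trans x_big.
  have t0 : time x = 0.
    rewrite /time max_l ?min_r//.
    by rewrite subr_le0 ler_peMr.
  exists (Num.sqrt (sqnorm x))^-1.
    by rewrite invr_gt0 sqrtr_gt0 lt0r sqnorm_eq0 x0 sqnorm_ge0.
  by rewrite /G t0 H0 set_valE /= /normalize (negbTE x0) mxE.
have [x i xi|x i xi|x Gx0] := poincare_miranda cG.
- have [|c c0 ->] := G_out x i; first by rewrite xi normrN1.
  by rewrite xi mulrN1 oppr_le0 ltW.
- have [|c c0 ->] := G_out x i; first by rewrite xi normr1.
  by rewrite xi mulr1.
have := sphere_val (H (time x, to_sphere x)); rewrite -/(G x) Gx0.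
by rewrite /sphere /= big1 => [/esym/eqP|i _]; rewrite ?oner_eq0// mxE expr0n.
Qed.

End sphere_essential.

(** * Essential maps, first countability and continua *)

Definition first_countable (X : topologicalType) := forall x : X,
  exists U : nat -> set X, (forall k, nbhs x (U k)) /\
    forall V, nbhs x V -> \forall k \near \oo, U k `<=` V.

Lemma pseudometric_first_countable (R : realType) (X : pseudoMetricType R) :
  first_countable X.
Proof.
move=> x; exists (fun k => ball x k.+1%:R^-1); split=> [k|V].
  exact: nbhsx_ballx.
move=> /nbhs_ballP[e /= e0 eV].
apply: filterS (near_infty_natSinv_lt (PosNum e0)) => k /= ke.
by apply: subset_trans eV; apply: le_ball; exact: ltW.
Qed.

Lemma homeomorphic_first_countable (X Y : topologicalType) :
  homeomorphic X Y -> first_countable Y -> first_countable X.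
Proof.
move=> [f [g [cf cg fK gK]]] fcY x; have [U [xU UV]] := fcY (f x).
exists (fun k => f @^-1` U k); split=> [k|V xV]; first exact: cf.
have : nbhs (f x) (g @^-1` V) by apply: cg; rewrite fK.
move=> /UV; apply: filterS => k kV y /= /kV /=.
by rewrite fK.
Qed.

Lemma subtype_first_countable (X : topologicalType) (A : set X) :
  first_countable X -> first_countable (set_type A).
Proof.
move=> fcX x; have [U [xU UV]] := fcX (set_val x).
exists (fun k => set_val @^-1` U k); split=> [k|V].
  exact: set_val_continuous.
move=> [_ /= [[B oB <-] /= Bx BV]].
have : nbhs (set_val x) B by exact: open_nbhs_nbhs.
move=> /UV; apply: filterS => k kB y /= /kB; exact: BV.
Qed.

Section wild_points.
Context (R : realType) (n : nat).

Definition essential (X : topologicalType) (f : Sn R n -> X) :=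
  continuous f /\ ~ null_homotopic R f.

(** A contraction of [g \o f] composed with the retraction [h] would contract
    [f]. *)
Lemma essential_retract (X Y : topologicalType) (g : X -> Y) (h : Y -> X)
    (f : Sn R n -> X) :
  continuous g -> continuous h -> cancel g h -> essential f ->
  essential (g \o f).
Proof.
move=> cg ch gK [cf nf]; split.
  by move=> x; apply: continuous_comp; [exact: cf|exact: cg].
move=> /(null_homotopic_comp ch); rewrite (_ : h \o (g \o f) = f)//.
by apply/funext => x /=.
Qed.

Lemma fwP (X : topologicalType) (x : X) : first_countable X ->
  fw R n X x <-> forall V, nbhs x V ->
    exists f : Sn R n -> X, essential f /\ range f `<=` V.
Proof.
move=> fcX; split=> [[f [cf nf fx]] V /fx[K _ KV]|small].
  by exists (f K); split; [split|exact: KV (leqnn K)].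
have [U [xU UV]] := fcX x.
have [f fP] := choice (fun k => small _ (xU k)).
exists f; split=> [k|k|V /UV]; try by case: (fP k) => -[].
apply: filterS => k kV; apply: subset_trans kV.
by case: (fP k).
Qed.

Lemma fw_retract (X Y : topologicalType) (g : X -> Y) (h : Y -> X) (x : X) :
  continuous g -> continuous h -> cancel g h -> fw R n X x -> fw R n Y (g x).
Proof.
move=> cg ch gK [f [cf nf fx]]; exists (fun k => g \o f k).
have ess k : essential (g \o f k) by exact: essential_retract ch gK _.
split=> [k|k|V /(cg x)/fx]; try by case: (ess k).
by apply: filterS => k kV _ [s _ <-]; apply: kV; exists s.
Qed.

(** Being wild is tested on neighbourhoods, and a neighbourhood of a limit of
    wild points is a neighbourhood of a wild point. *)
Lemma closed_fw_in (X : topologicalType) (A : set X) :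
  first_countable X -> closed A -> closed (fw_in R n A).
Proof.
move=> fcX cA x clx.
have Ax : A x by apply: cA; apply: closureS clx; exact: fw_in_sub.
exists (exist _ x (mem_set Ax)) => //.
apply/fwP; first exact: subtype_first_countable.
move=> V [_ /= [[B oB <-] /= Bx BV]].
have [y [[a fwa ay] By]] : fw_in R n A `&` B !=set0.
  by apply: clx; apply: open_nbhs_nbhs.
move: fwa => /fwP-/(_ (subtype_first_countable fcX)).
apply; apply: (filterS BV); apply: set_val_continuous.
by apply: open_nbhs_nbhs; split=> //; rewrite ay.
Qed.

(** A subspace of a subspace of [E] is a subspace of [E]; this comparison map
    allows all iterates to be computed inside one ambient space. *)
Definition subset_image (E : topologicalType) (Y : set E) (A : set (set_type Y))
    (a : set_type A) : set_type (set_val @` A : set E) :=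
  exist _ (set_val (set_val a)) (mem_set (imageP set_val (set_valP a))).

Lemma subset_image_homeo (E : topologicalType) (Y : set E) (A : set (set_type Y)) :
  exists h : set_type (set_val @` A : set E) -> set_type A,
  [/\ continuous (@subset_image E Y A), continuous h,
      cancel (@subset_image E Y A) h & cancel h (@subset_image E Y A)].
Proof.
have pre (b : set_type (set_val @` A : set E)) :
    exists a : set_type A, subset_image a = b.
  have [y Ay yb] := set_valP b.
  by exists (exist _ y (mem_set Ay)); apply/val_inj.
have [h hK] := choice pre; exists h; split=> // a.
- apply: subtype_continuous.
  by apply: (@continuous_comp _ _ _ set_val set_val); exact: set_val_continuous.
- apply: subtype_continuous; apply: subtype_continuous.
  rewrite (_ : _ \o _ = set_val); first exact: set_val_continuous.
  by apply/funext => c /=; rewrite -[in RHS](hK c).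
- apply: set_val_inj; apply: set_val_inj.
  exact: (congr1 set_val (hK (subset_image a))).
Qed.

Lemma fw_in_val (E : topologicalType) (Y : set E) (A : set (set_type Y)) :
  set_val @` fw_in R n A = fw_in R n (set_val @` A : set E).
Proof.
have [h [cg ch gK hK]] := subset_image_homeo A.
apply/seteqP; split=> [_ [_ [a fwa <-] <-]|_ [b fwb <-]].
  by exists (subset_image a) => //; exact: fw_retract fwa.
exists (set_val (h b)); first by exists (h b) => //; exact: fw_retract fwb.
by rewrite -[in RHS](hK b).
Qed.

End wild_points.

Lemma compact_set_type (X : topologicalType) (A : set X) :
  compact A -> compact [set: set_type A].
Proof.
move=> cA F PF _; have [|x [Ax xF]] := cA (set_val @ F) _.
  have : \forall a \near F, A (set_val a) by apply: nearW => a; exact: set_valP.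
  exact.
exists (exist _ x (mem_set Ax)); split=> // B C FB [_ /= [[D oD <-] /= Dx DC]].
have FvB : (set_val @ F) (set_val @` B).
  have : \forall a \near F, (set_val @` B) (set_val a).
    by apply: filterS FB => b Bb; exists b.
  exact.
have [_ [[b Bb <-] Db]] := xF _ D FvB (open_nbhs_nbhs (conj oD Dx)).
by exists b; split=> //; exact: DC.
Qed.

Lemma compact_continuum (R : realType) (E : normedModType R) (A : set E) :
  compact A -> continuum R (set_type A).
Proof.
move=> cA; split; first exact: compact_set_type.
pose d (x y : set_type A) : R := `|set_val x - set_val y|.
have d_ge0 x y : 0 <= d x y by exact: normr_ge0.
have d_eq0 x y : d x y = 0 -> x = y.
  by move=> /normr0_eq0/eqP; rewrite subr_eq0 => /eqP/val_inj.
have ballE (x : set_type A) e : ball x e = [set y | d x y < e].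
  by apply/seteqP; split=> y; rewrite /d /ball /= /initial_ball -ball_normE.
pose M : metricType R := HB.pack (set_type A)
  (PseudoMetric_isMetric.Build R (set_type A) d_ge0 d_eq0 ballE).
by exists M, (fun x => x), (fun x => x); split=> // x.
Qed.

Lemma metrizable_first_countable (R : realType) (X : topologicalType) :
  metrizable R X -> first_countable X.
Proof.
move=> [M XM]; apply: homeomorphic_first_countable XM _.
exact: (@pseudometric_first_countable R M).
Qed.

Lemma continuum_second_countable (R : realType) (X : topologicalType) :
  continuum R X -> @second_countable X.
Proof.
move=> [cX [M [f [g [cf cg fK gK]]]]].
have [[x0 _]|X0] := pselect ([set: X] !=set0); last first.
  exists set0 => //; split=> // x.
  by case: X0; exists x.
pose PM : pseudoPMetricType R := HB.pack (Metric.sort M)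
  (Metric.class M) (isPointed.Build (Metric.sort M) (f x0)).
have cM : compact [set: PM].
  rewrite (_ : [set: PM] = f @` [set: X]); last first.
    by apply/seteqP; split=> // y _; exists (g y) => //; exact: gK.
  apply: continuous_compact => //; exact: continuous_subspaceT.
have [B countB [openB basisB]] := @compact_second_countable R PM cM.
exists [set f @^-1` U | U in B]; first exact: sub_countable (card_image_le _ _) countB.
split=> [_ [U BU <-]|x V xV].
  by move/continuousP : cf; apply; exact: openB.
have : nbhs (f x) (g @^-1` V) by apply: cg; rewrite fK.
move=> /(basisB (f x))[U [BU Ufx] UV]; exists (f @^-1` U) => /=.
  by split=> //; exists U.
by move=> y /UV /=; rewrite fK.
Qed.

Theorem continuum_rank (R : realType) (n : nat) (X : topologicalType) :
  continuum R X -> exists k : ordinal_type, countable_ordinal k /\ is_fwrk R n X k.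
Proof.
move=> XC; apply: rank_exists (continuum_second_countable XC) _ => A.
exact: closed_fw_in (metrizable_first_countable XC.2).
Qed.

(** * Trees of spheres *)

Section dot_product.
Context (R : realType) (n : nat).
Local Notation V := 'rV[R]_n.+1.

Definition dot (x y : V) : R := \sum_i x 0 i * y 0 i.

Lemma dot_continuous (y : V) : continuous (dot^~ y).
Proof.
apply: (@continuous_big R^o) => [|i _]; first exact: add_continuous.
move=> x; apply: (@continuousM R V (fun x : V => x 0 i)).
  exact: coord_continuous.
exact: cst_continuous.
Qed.

Lemma dotxx x : dot x x = sqnorm x.
Proof. by apply: eq_bigr => i _; rewrite -expr2. Qed.

Lemma dot0l y : dot 0 y = 0.
Proof. by rewrite /dot big1// => i _; rewrite mxE mul0r. Qed.

Lemma dotDl x x' y : dot (x + x') y = dot x y + dot x' y.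
Proof. by rewrite -big_split; apply: eq_bigr => i _; rewrite mxE mulrDl. Qed.

Lemma dotZl c x y : dot (c *: x) y = c * dot x y.
Proof. by rewrite mulr_sumr; apply: eq_bigr => i _; rewrite mxE mulrA. Qed.

(** The segment joining [f x] to [s] avoids the origin, as its points have
    positive scalar product with [s]; it is projected back to the sphere. *)
Lemma hemisphere_null (X : topologicalType) (f : X -> Sn R n) (s : Sn R n) :
  continuous f -> (forall x, 0 < dot (set_val (f x)) (set_val s)) ->
  null_homotopic R f.
Proof.
move=> cf f_pos; exists s.
pose L (p : R * X) : V := (1 - p.1) *: set_val (f p.2) + p.1 *: set_val s.
exists (fun p => to_sphere (L p)); split=> [|x|x]; last 2 first.
- by rewrite /L /= subr0 scale1r scale0r addr0 to_sphereK.
- by rewrite /L /= subrr scale0r scale1r add0r to_sphereK.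
have cL : continuous L.
  move=> p; apply: (@continuousD R V (R * X)%type).
    apply: (@continuousZ R V (R * X)%type).
      apply: (@continuousB R R^o (R * X)%type); first exact: cst_continuous.
      exact: fst_continuous.
    apply: (@continuous_comp _ (Sn R n) V _ set_val); last exact: set_val_continuous.
    by apply: (@continuous_comp _ X); [exact: snd_continuous|exact: cf].
  apply: (@continuousZ R V (R * X)%type); first exact: fst_continuous.
  exact: cst_continuous.
apply: continuous_in_subspaceT => -[t x]; rewrite inE => -[/=].
rewrite in_itv /= => /andP[t0 t1] _.
apply: (@continuous_comp _ _ _ L (@to_sphere R n)); first exact: cL.
apply: to_sphere_continuous; apply/eqP => L0.
have : 0 < dot (L (t, x)) (set_val s).
  have ss : dot (set_val s) (set_val s) = 1 by rewrite dotxx; exact: sphere_val.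
  rewrite dotDl !dotZl ss mulr1 /=.
  have [->|tn0] := eqVneq t 0; first by rewrite subr0 mul1r addr0.
  apply: ltr_wpDl; last by rewrite lt0r tn0.
  by rewrite mulr_ge0 ?subr_ge0// ltW.
by rewrite L0 dot0l ltxx.
Qed.

End dot_product.

(** The pieces hanging from a sphere are numbered by natural numbers. The piece
    of number [k] sits over the point [center k] and, when [kind k] is [Some u],
    may be occupied by a tree of type [u]; it is occupied in a tree of type [v]
    if [u] is a child of [v] and is present. Thus all pieces of a given number
    have the same position relative to their sphere, whatever the type. *)
Section sphere_trees.
Context (R : realType) (n : nat).
Local Notation V := 'rV[R]_n.+1.
Local Notation E := (V * R)%type.
Context (W : Type) (kind : nat -> option W) (center : nat -> V).
Hypothesis center_sphere : forall k, sphere R n (center k).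
Hypothesis center_dense : forall (u : W) (x : V) (e : R) (K : nat),
  sphere R n x -> 0 < e ->
  exists k, [/\ (K <= k)%N, kind k = Some u & `|x - center k| < e].
Context (child : W -> W -> Prop).
Implicit Types (P Q : set W) (u v : W) (z y : E) (k : nat).

Definition height k : R := 2^-1 ^+ k.

(** The factor 1/(8(n+1)) keeps the pieces disjoint from each other and, as
    points of the sphere have a coordinate of absolute value at least 1/(n+1),
    away from the vertical axis. *)
Definition ratio k : R := (8 * n.+1%:R)^-1 * height k.

Lemma height_gt0 k : 0 < height k.
Proof. by rewrite exprn_gt0// invr_gt0. Qed.

Lemma height_le1 k : height k <= 1.
Proof. by rewrite exprn_ile1// ?invr_ge0// invf_le1 ?ler1n. Qed.

Lemma height_lt k k' : (k < k')%N -> 2 * height k' <= height k.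
Proof.
move=> kk'; rewrite /height -(subnKC kk') exprD exprS !mulrA mulfV// mul1r.
by rewrite ler_piMr ?exprn_ge0 ?invr_ge0// height_le1.
Qed.

Lemma height_small (e : R) : 0 < e -> exists K, forall k, (K <= k)%N -> height k < e.
Proof.
move=> e0; have [K _ KP] := near_infty_natSinv_expn_lt (PosNum e0).
exists K => k /KP; rewrite /height /= exprVn div1r; apply: le_lt_trans.
by rewrite lexx.
Qed.

Lemma ratio_gt0 k : 0 < ratio k.
Proof. by rewrite mulr_gt0 ?height_gt0// invr_gt0 mulr_gt0 ?ltr0n. Qed.

Lemma ratio_neq0 k : ratio k != 0.
Proof. by rewrite gt_eqF ?ratio_gt0. Qed.

Lemma ratio_le k : 8 * ratio k <= height k.
Proof.
have -> : 8 * ratio k = n.+1%:R^-1 * height k.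
  by rewrite /ratio invfM !mulrA mulfV ?mul1r.
rewrite ler_piMl ?(ltW (height_gt0 k))//.
by rewrite invf_le1 ?ler1n ?ltr0n.
Qed.

Definition place k z : E := (center k + ratio k *: z.1, height k + ratio k * z.2).
Definition unplace k z : E :=
  ((ratio k)^-1 *: (z.1 - center k), (ratio k)^-1 * (z.2 - height k)).

Lemma placeK k : cancel (place k) (unplace k).
Proof.
move=> [x t]; rewrite /unplace /place /= (addrC (center k)) (addrC (height k)).
by rewrite !addrK scalerK ?mulKf ?ratio_neq0.
Qed.

Lemma unplaceK k : cancel (unplace k) (place k).
Proof.
move=> [x t]; rewrite /unplace /place /= scalerKV ?mulVKf ?ratio_neq0//.
by rewrite !subrKC.
Qed.

Lemma place_continuous k : continuous (place k).
Proof.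
move=> z; apply: (@pair_continuous E V R (fun z => center k + ratio k *: z.1)
  (fun z => height k + ratio k * z.2)).
  apply: (@continuousD R V E (cst (center k))); first exact: cst_continuous.
  by apply: (@continuousZ R V E (cst (ratio k))); [exact: cst_continuous|exact: fst_continuous].
apply: (@continuousD R R^o E (cst (height k))); first exact: cst_continuous.
by apply: (@continuousM R E (cst (ratio k))); [exact: cst_continuous|exact: snd_continuous].
Qed.

Lemma unplace_continuous k : continuous (unplace k).
Proof.
move=> z; apply: (@pair_continuous E V R (fun z => (ratio k)^-1 *: (z.1 - center k))
  (fun z => (ratio k)^-1 * (z.2 - height k))).
  apply: (@continuousZ R V E (cst (ratio k)^-1)); first exact: cst_continuous.
  by apply: (@continuousB R V E fst (cst (center k))); [exact: fst_continuous|exact: cst_continuous].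
apply: (@continuousM R E (cst (ratio k)^-1)); first exact: cst_continuous.
by apply: (@continuousB R R^o E snd (cst (height k))); [exact: snd_continuous|exact: cst_continuous].
Qed.

(** A region containing the unit sphere at height 0 and mapped into itself by
    all the similarities [place k]. *)
Definition room : set E := [set z | `|z.1| <= 2 /\ 0 <= z.2 <= 2].

Definition core : set E := [set z | sphere R n z.1 /\ z.2 = 0].

Lemma sphere_norm_le1 (x : V) : sphere R n x -> `|x| <= 1.
Proof.
rewrite /sphere /= => x1; apply: norm_le_coord => // i.
rewrite -(@ler_pXn2r _ 2)// ?nnegrE// expr1n real_normK ?num_real//.
by rewrite -x1 (bigD1 i)//= lerDl sumr_ge0// => j _; rewrite sqr_ge0.
Qed.

Lemma sphere_norm_ge (x : V) : sphere R n x -> 1 <= n.+1%:R * `|x|.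
Proof.
move=> sx; have x1 := sphere_norm_le1 sx; move: sx; rewrite /sphere /= => sx.
rewrite -[leLHS]sx mulr_natl -[X in _ *+ X]card_ord -sumr_const.
apply: ler_sum => i _; rewrite -real_normK ?num_real//.
have xi := coord_le_norm x i; apply: le_trans xi.
by rewrite expr2 ler_piMl// (le_trans (coord_le_norm x i)).
Qed.

Lemma core_room : core `<=` room.
Proof.
move=> z [/sphere_norm_le1 z1 z2]; split; last by rewrite z2 lexx ler0n.
by apply: le_trans z1 _; rewrite ler1n.
Qed.

(** A piece occupies heights in a fixed interval from h to 5h/4, where h is
    divided by 2 from one number to the next; so pieces are disjoint, and
    separated by gaps. *)
Lemma place_height k z : room z -> 4 * height k <= 4 * (place k z).2 <= 5 * height k.
Proof.
move=> [_ /andP[z0 z2]]; rewrite /place /=; have := ratio_le k; have := ratio_gt0 k.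
move=> r0 r8; nra.
Qed.

Lemma place_offset k z : room z -> `|(place k z).1 - center k| <= 2 * ratio k.
Proof.
move=> [z2 _]; rewrite /place /= [_ + _ *: _]addrC addrK normrZ gtr0_norm ?ratio_gt0//.
by rewrite mulrC ler_wpM2r// ltW// ratio_gt0.
Qed.

Lemma place_room k z : room z -> room (place k z).
Proof.
move=> zr; have := place_height k zr; have := place_offset k zr.
have := ratio_le k; have := height_le1 k; have := height_gt0 k; have := ratio_gt0 k.
move=> r0 h0 h1 r8 off /andP[hl hr]; split; last by apply/andP; split; lra.
rewrite -(subrK (center k) (place k z).1); apply: le_trans (ler_normD _ _) _.
have := sphere_norm_le1 (center_sphere k); lra.
Qed.

Lemma place_inj k k' z z' : room z -> room z' -> place k z = place k' z' ->
  k = k' /\ z = z'.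
Proof.
move=> zr zr' eqp; have kk' : k = k'.
  have := place_height k zr; have := place_height k' zr'; rewrite eqp.
  case: (ltngtP k k') => // /height_lt; have := height_gt0 k; have := height_gt0 k';
    move=> h0 h0' hh /andP[a b] /andP[c d]; exfalso; clear eqp; lra.
by split=> //; rewrite -kk' in eqp; exact: (can_inj (@placeK k)) eqp.
Qed.

Definition tree_step P (Y : W -> set E) v : set E := [set z |
  [/\ P v, room z & core z \/
    exists k u y, [/\ kind k = Some u, child v u, Y u y & z = place k y]]].

(** The greatest solution of the recursive equation: a union of all its
    post-fixed families. A point is either in the core of some nested piece, or
    belongs to infinitely many nested pieces. *)
Definition sphere_tree P v : set E := [set z |
  exists Y : W -> set E, (forall u, Y u `<=` tree_step P Y u) /\ Y v z].

Lemma sphere_tree_coind P (Y : W -> set E) :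
  (forall u, Y u `<=` tree_step P Y u) -> forall v, Y v `<=` sphere_tree P v.
Proof. by move=> YP v z Yz; exists Y. Qed.

Lemma tree_step_mono P (Y Y' : W -> set E) v : (forall u, Y u `<=` Y' u) ->
  tree_step P Y v `<=` tree_step P Y' v.
Proof.
move=> YY z [Pv zr H]; split=> //; case: H => [|[k [u [y [ku vu Yy zE]]]]]; first by left.
by right; exists k, u, y; split=> //; exact: YY.
Qed.

Lemma sphere_tree_unfold P v : sphere_tree P v `<=` tree_step P (sphere_tree P) v.
Proof.
move=> z [Y [YP Yz]]; apply: tree_step_mono (YP _ _ Yz) => u y Yy.
by exists Y.
Qed.

Lemma sphere_tree_room P v : sphere_tree P v `<=` room.
Proof. by move=> z /sphere_tree_unfold[]. Qed.

Lemma sphere_tree_alive P v z : sphere_tree P v z -> P v.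
Proof. by move=> /sphere_tree_unfold[]. Qed.

Lemma sphere_tree_fold P v : tree_step P (sphere_tree P) v `<=` sphere_tree P v.
Proof.
apply: (@sphere_tree_coind P (tree_step P (sphere_tree P))) => u.
by apply: tree_step_mono => w; exact: sphere_tree_unfold.
Qed.

Lemma core_sphere_tree P v z : P v -> core z -> sphere_tree P v z.
Proof.
by move=> Pv cz; apply: sphere_tree_fold; split=> //; [exact: core_room|left].
Qed.

Lemma place_sphere_tree P v k u y : P v -> kind k = Some u -> child v u ->
  sphere_tree P u y -> sphere_tree P v (place k y).
Proof.
move=> Pv ku vu Py; apply: sphere_tree_fold; split=> //.
  by apply: place_room; exact: sphere_tree_room Py.
by right; exists k, u, y.
Qed.

Lemma sphere_tree_mono P Q v : P `<=` Q -> sphere_tree P v `<=` sphere_tree Q v.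
Proof.
move=> PQ; apply: (sphere_tree_coind (Y := sphere_tree P)) => u z.
by move=> /sphere_tree_unfold[/PQ].
Qed.

Lemma core_place z k y : room y -> core z -> z <> place k y.
Proof.
move=> yr [_ z0] zE; have := place_height k yr; rewrite -zE z0 mulr0.
by have := height_gt0 k => h0 /andP[]; rewrite leNgt mulr_gt0.
Qed.

(** The pieces being disjoint, a point has the same address in all the trees. *)
Lemma sphere_tree_bigcap (I : Type) (D : set I) (P : I -> set W) v : D !=set0 ->
  \bigcap_(i in D) sphere_tree (P i) v = sphere_tree (\bigcap_(i in D) P i) v.
Proof.
move=> [i0 Di0]; apply/seteqP; split; last first.
  move=> z Pz i Di; apply: sphere_tree_mono Pz => u; exact.
pose Y u := \bigcap_(i in D) sphere_tree (P i) u.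
apply: (sphere_tree_coind (Y := Y)) => u z Yz.
split; [by move=> i /Yz/sphere_tree_alive|exact: sphere_tree_room (Yz _ Di0)|].
have [_ zr [cz|[k [w [y [kw uw Py zE]]]]]] := sphere_tree_unfold (Yz _ Di0); first by left.
right; exists k, w, y; split=> // i Di.
have yr := sphere_tree_room Py.
have [_ _ []] := sphere_tree_unfold (Yz _ Di); first by move=> /(core_place (k := k) yr).
move=> [k' [w' [y' [kw' uw' Py' zE']]]].
have [kk' yy'] : k = k' /\ y = y'.
  by apply: place_inj; [|exact: sphere_tree_room Py'|rewrite -zE].
by move: kw' Py'; rewrite -kk' -yy' kw => -[<-].
Qed.

Lemma nbhs_pairP z (U : set E) : nbhs z U <-> exists2 e : R, 0 < e &
  forall y, `|z.1 - y.1| < e -> `|z.2 - y.2| < e -> U y.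
Proof.
split=> [[[A B] /= [/nbhs_ballP[a /= a0 aA] /nbhs_ballP[b /= b0 bB]] AB]|[e e0 eU]].
  exists (Order.min a b); first by rewrite lt_min a0.
  move=> y; rewrite !lt_min => /andP[ya _] /andP[_ yb]; apply: AB; split.
    by apply: aA; rewrite -ball_normE.
  by apply: bB; rewrite -ball_normE.
exists (ball z.1 e, ball z.2 e); first by split; exact: nbhsx_ballx.
by move=> y [/=]; rewrite -!ball_normE /= => *; exact: eU.
Qed.

Lemma closed_sphere : closed (sphere R n).
Proof.
rewrite (_ : sphere R n = @sqnorm R n @^-1` [set x | x = 1])//.
by apply: preimage_closed => [x _|]; [exact: sqnorm_continuous|exact: closed_eq].
Qed.

Lemma closed_room : closed room.
Proof.
rewrite (_ : room = (fun z => `|z.1|) @^-1` [set x : R | x <= 2] `&`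
    (snd @^-1` [set x : R | 0 <= x] `&` snd @^-1` [set x : R | x <= 2])).
  apply: closedI; [|apply: closedI]; apply: preimage_closed => [z _|].
  - by apply: (@continuous_comp E V R fst); [exact: fst_continuous|exact: norm_continuous].
  - exact: closed_le.
  - exact: snd_continuous.
  - exact: closed_ge.
  - exact: snd_continuous.
  - exact: closed_le.
by apply/seteqP; split=> [z [z1 /andP[]]|z [z1 [z2 z3]]] //; split=> //; apply/andP.
Qed.

(** A piece is close to its center compared with its height. *)
Lemma sphere_tree_near_core P v z : sphere_tree P v z ->
  exists2 x, sphere R n x & `|z.1 - x| <= z.2.
Proof.
move=> /sphere_tree_unfold[_ zr [[z1 z2]|[k [u [y [_ _ Py zE]]]]]].
  by exists z.1 => //; rewrite subrr normr0 z2.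
exists (center k) => //; rewrite zE.
have yr := sphere_tree_room Py.
have := place_offset k yr; have := place_height k yr; have := ratio_le k.
have := ratio_gt0 k => r0 r8 /andP[hl hr] off; lra.
Qed.

(** The closures form a post-fixed family. A limit at positive height is
    approached from a single piece, because two pieces whose heights are both
    close to that of the limit coincide. A limit at height 0 is on the sphere,
    because the distance to the sphere is bounded by the height. *)
Lemma closed_sphere_tree P v : closed (sphere_tree P v).
Proof.
apply: (sphere_tree_coind (Y := fun v => closure (sphere_tree P v))) => {}v z clz.
have [y0 [Py0 _]] := clz setT filterT.
have Pv := sphere_tree_alive Py0.
have zr : room z.
  by apply: closed_room; apply: closureS clz; exact: sphere_tree_room.
have near_z (e : R) : 0 < e -> exists y,
    [/\ sphere_tree P v y, `|z.1 - y.1| < e & `|z.2 - y.2| < e].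
  move=> e0; have [|y [Py [y1 y2]]] :=
      clz [set y | `|z.1 - y.1| < e /\ `|z.2 - y.2| < e].
    by apply/nbhs_pairP; exists e.
  by exists y.
split=> //; have [_ /andP[z_ge0 z_le2]] := zr.
move: z_ge0; rewrite le_eqVlt => /orP[/eqP z0|z_gt0].
  left; split=> //; apply: closed_sphere => U /nbhs_ballP[e /= e0 eU].
  have e2 : 0 < e / 2 by rewrite divr_gt0.
  have [y [Py y1 y2]] := near_z _ e2.
  have [x sx xy] := sphere_tree_near_core Py.
  exists x; split=> //; apply: eU; rewrite -ball_normE /=.
  rewrite -(subrK y.1 z.1) -addrA; apply: le_lt_trans (ler_normD _ _) _.
  rewrite (splitr e) ltrD//; apply: le_lt_trans xy _; apply: le_lt_trans y2.
  by rewrite -z0 sub0r normrN ler_norm.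
right; have e0 : 0 < z.2 / 8 by rewrite divr_gt0.
(* Two pieces satisfying this estimate have parameters h of ratio less than 2,
   since 12/10 : 7/10 is less than 2. *)
have heights k y' : room y' -> `|z.2 - (place k y').2| < z.2 / 8 ->
    7 * z.2 < 10 * height k < 12 * z.2.
  move=> yr; have /andP[hl hr] := place_height k yr.
  by rewrite ltr_norml => /andP[a b]; apply/andP; split; lra.
have in_piece y : sphere_tree P v y -> `|z.2 - y.2| < z.2 / 8 -> exists k u y',
    [/\ kind k = Some u, child v u, sphere_tree P u y' & y = place k y'].
  move=> /sphere_tree_unfold[_ _ [[_ y2]|//]].
  by rewrite y2 subr0 gtr0_norm// => z8; exfalso; lra.
have [y [Py _ y2]] := near_z _ e0.
have [k [u [y' [ku vu Py' yE]]]] := in_piece _ Py y2.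
exists k, u, (unplace k z); rewrite unplaceK; split=> // U zU.
have [|w [Pw [Uw w2]]] := clz (unplace k @^-1` U `&` [set w | `|z.2 - w.2| < z.2 / 8]).
  apply: filterI; first exact: unplace_continuous.
  by apply/nbhs_pairP; exists (z.2 / 8).
have [k' [u' [w' [ku' vu' Pw' wE]]]] := in_piece _ Pw w2.
have kk' : k = k'.
  have := heights k y' (sphere_tree_room Py'); rewrite -yE => /(_ y2)/andP[a b].
  have := heights k' w' (sphere_tree_room Pw'); rewrite -wE => /(_ w2)/andP[c d].
  by case: (ltngtP k k') => // /height_lt H; exfalso; clear yE wE; lra.
exists w'; split; last by move: Uw; rewrite /preimage /= wE -kk' placeK.
by move: ku'; rewrite -kk' ku => -[->].
Qed.

Lemma compact_sphere_tree P v : compact (sphere_tree P v).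
Proof.
have cV : compact [set x : V | forall i, `[-2, 2]%classic (x 0 i)].
  by apply: (@rV_compact R^o _ (fun=> `[-2, 2]%classic)) => _; exact: segment_compact.
have cR : compact (`[0, 2]%classic : set R) by exact: segment_compact.
apply: subclosed_compact (@closed_sphere_tree P v) (compact_setX cV cR) _.
move=> z /sphere_tree_room[z1 z2]; split; last by rewrite /= in_itv.
by move=> i /=; rewrite in_itv /= -ler_norml; apply: le_trans z1; exact: coord_le_norm.
Qed.

Lemma continuum_sphere_tree P v : continuum R (set_type (sphere_tree P v)).
Proof. by apply: compact_continuum; exact: compact_sphere_tree. Qed.

Local Notation tree P v := (set_type (sphere_tree P v)).

Lemma sphere_neq0 (x : V) : sphere R n x -> x != 0.
Proof.
by move=> /sphere_norm_ge; apply: contraTneq => ->; rewrite normr0 mulr0 ler10.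
Qed.

Lemma sphere_tree_neq0 P v z : sphere_tree P v z -> z.1 != 0.
Proof.
move=> /sphere_tree_unfold[_ _ [[/sphere_neq0//]|[k [u [y [_ _ Py zE]]]]]].
have off := place_offset k (sphere_tree_room Py); rewrite -zE in off.
apply: contraTneq off => ->; rewrite sub0r normrN -ltNge.
have h1 := height_le1 k; have n0 : 0 < n.+1%:R :> R by rewrite ltr0n.
have c1 := sphere_norm_ge (center_sphere k).
have r8 : 8 * (n.+1%:R * ratio k) <= 1.
  by rewrite mulrA -/(ratio k) /ratio mulrA mulfV ?mul1r// mulf_neq0// gt_eqF.
rewrite -(ltr_pM2l n0) mulrCA.
move: (n.+1%:R * ratio k) (n.+1%:R * `|center k|) r8 c1 => t c t8 c1; lra.
Qed.

Lemma core_room_pair (s : Sn R n) : core (set_val s, 0).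
Proof. by split=> //; exact: sphere_val. Qed.

Definition core_incl P v (Pv : P v) (s : Sn R n) : tree P v :=
  exist _ (set_val s, 0) (mem_set (core_sphere_tree Pv (core_room_pair s))).

Lemma val_core_incl P v (Pv : P v) s : set_val (core_incl Pv s) = (set_val s, 0).
Proof. by []. Qed.

(** The vertical projection followed by the radial one; it retracts the tree
    onto its central sphere. *)
Definition core_proj P v (z : tree P v) : Sn R n := to_sphere (set_val z).1.

Lemma core_incl_proj P v (Pv : P v) (z : tree P v) :
  core (set_val z) -> core_incl Pv (core_proj z) = z.
Proof.
move=> [z1 z2]; apply: set_val_inj; rewrite val_core_incl [RHS]surjective_pairing z2.
by rewrite /core_proj set_valE /= normalize_id.
Qed.

Lemma core_incl_continuous P v (Pv : P v) : continuous (core_incl Pv).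
Proof.
move=> s; apply: subtype_continuous.
apply: (@pair_continuous (Sn R n) V R set_val (cst 0)); last exact: cst_continuous.
exact: set_val_continuous.
Qed.

Lemma core_proj_continuous P v : continuous (@core_proj P v).
Proof.
move=> z; apply: (@continuous_comp _ V _ (fun z : tree P v => (set_val z).1)).
  by apply: (@continuous_comp _ E _ set_val fst); [exact: set_val_continuous|exact: fst_continuous].
by apply: to_sphere_continuous; exact: sphere_tree_neq0 (set_valP z).
Qed.

Lemma core_inclK P v (Pv : P v) : cancel (core_incl Pv) (@core_proj P v).
Proof. by move=> s; rewrite /core_proj set_valE /= to_sphereK. Qed.

Lemma core_essential P v (Pv : P v) : essential (core_incl Pv).
Proof.
have id_ess : essential (@id (Sn R n)).
  by split; [move=> x; exact: cvg_id|exact: sphere_id_essential].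
have := essential_retract (@core_incl_continuous P v Pv) (@core_proj_continuous P v)
  (core_inclK Pv) id_ess.
exact.
Qed.

Section piece.
Context (P : set W) (v u : W) (k : nat).
Hypotheses (Pv : P v) (ku : kind k = Some u) (vu : child v u).

Definition piece_in (y : tree P u) : tree P v :=
  exist _ (place k (set_val y)) (mem_set (place_sphere_tree Pv ku vu (set_valP y))).

Lemma val_piece_in (y : tree P u) : set_val (piece_in y) = place k (set_val y).
Proof. by []. Qed.

Lemma piece_in_continuous : continuous piece_in.
Proof.
move=> y; apply: subtype_continuous.
by apply: (@continuous_comp _ E E set_val); [exact: set_val_continuous|exact: place_continuous].
Qed.

(** An open slab of heights around the piece [k] which meets no other piece, so
    that it cuts a clopen subset out of the tree. *)
Definition window z := 3 * height k < 4 * z.2 < 6 * height k.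

Lemma window_place y : room y -> window (place k y).
Proof.
move=> /(place_height k)/andP[a b]; have := height_gt0 k => h0.
by apply/andP; split; move: a b h0; clear ku; lra.
Qed.

Lemma windowE z : sphere_tree P v z -> window z ->
  exists2 y, sphere_tree P u y & z = place k y.
Proof.
move=> /sphere_tree_unfold[_ _ [[_ z2]|]].
  by rewrite /window z2 mulr0 ltNge mulr_ge0// ltW// height_gt0.
move=> [k' [u' [y [ku' vu' Py zE]]]] /andP[a b].
have kk' : k = k'.
  have := place_height k' (sphere_tree_room Py); rewrite -zE => /andP[c d].
  case: (ltngtP k k') => // /height_lt H; exfalso;
    have := height_gt0 k; have := height_gt0 k'; move: H a b c d; clear ku ku'; lra.
by move: ku'; rewrite -kk' ku => -[->]; exists y; rewrite // kk'.
Qed.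

Lemma window_open z : window z -> nbhs z window.
Proof.
move=> /andP[a b].
(* The distance from z.2 to the ends of the window. *)
pose e := Order.min (4 * z.2 - 3 * height k) (6 * height k - 4 * z.2) / 4.
have e0 : 0 < e by rewrite divr_gt0// lt_min !subr_gt0 a.
apply/nbhs_pairP; exists e => // y _.
rewrite /e ltr_pdivlMr// lt_min => /andP[c d]; apply/andP.
have := ler_norm (z.2 - y.2); have := ler_norm (y.2 - z.2).
by rewrite distrC => p q; split; move: a b c d p q; clear ku; lra.
Qed.

Lemma window_closed z : ~ window z ->
  nbhs z [set y | sphere_tree P v y -> ~ window y].
Proof.
move=> nwz.
(* The piece ends at 5h/4, which is at distance h/4 from the end of the window;
   it starts at h, at the same distance from the other end. *)
apply/nbhs_pairP; exists (height k / 8).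
  by rewrite divr_gt0 ?height_gt0.
move=> y _ yz Py wy; apply: nwz; have [y' Py' yE] := windowE Py wy.
have := place_height k (sphere_tree_room Py'); rewrite -yE => /andP[a b].
move: yz; rewrite ltr_norml => /andP[c d]; clear yE.
by apply/andP; split; lra.
Qed.

Context (y0 : tree P u).

(** The retraction onto a piece, collapsing everything outside it to one of its
    points. *)
Definition piece_retract z : E := if window z then unplace k z else set_val y0.

Lemma piece_retract_tree (z : tree P v) : sphere_tree P u (piece_retract (set_val z)).
Proof.
rewrite /piece_retract; case: ifPn => [|_]; last exact: set_valP.
move=> /(windowE (set_valP z))[y Py zE].
by rewrite (_ : set_val z = place k y)// placeK.
Qed.

Definition piece_out (z : tree P v) : tree P u :=
  exist _ (piece_retract (set_val z)) (mem_set (piece_retract_tree z)).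

Lemma val_piece_out (z : tree P v) : set_val (piece_out z) = piece_retract (set_val z).
Proof. by []. Qed.

Lemma piece_inK : cancel piece_in piece_out.
Proof.
move=> y; apply: set_val_inj; rewrite val_piece_out /piece_retract val_piece_in.
by rewrite window_place ?placeK//; exact: sphere_tree_room (set_valP y).
Qed.

Lemma piece_outK (z : tree P v) : window (set_val z) -> piece_in (piece_out z) = z.
Proof.
move=> wz; apply: set_val_inj.
by rewrite val_piece_in val_piece_out /piece_retract wz unplaceK.
Qed.

Lemma piece_out_continuous : continuous piece_out.
Proof.
move=> z; apply: subtype_continuous.
have [wz|nwz] := boolP (window (set_val z)).
  apply: (@near_eq_continuous _ _ (fun z : tree P v => unplace k (set_val z))).
    have : nbhs z (set_val @^-1` window).
      by apply: set_val_continuous; exact: window_open.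
    by apply: filterS => w ww; rewrite /= val_piece_out /piece_retract ww.
  apply: (@continuous_comp _ E E set_val); first exact: set_val_continuous.
  exact: unplace_continuous.
apply: (@near_eq_continuous _ _ (fun=> set_val y0)); last exact: cst_continuous.
have : nbhs z (set_val @^-1` [set y | sphere_tree P v y -> ~ window y]).
  by apply: set_val_continuous; apply: window_closed; exact/negP.
apply: filterS => w /= /(_ (set_valP w))/negP/negbTE nww.
by rewrite val_piece_out /piece_retract nww.
Qed.

End piece.

(** The effect of the wild set operator on the types that are present. *)
Definition derived P : set W := [set v | P v /\ exists2 u, child v u & P u].

Lemma tree_first_countable P v : first_countable (tree P v).
Proof. exact: metrizable_first_countable (continuum_sphere_tree P v).2. Qed.

Lemma room_diam z y : room z -> room y -> `|z.1 - y.1| <= 4 /\ `|z.2 - y.2| <= 4.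
Proof.
move=> [z1 /andP[z2 z3]] [y1 /andP[y2 y3]]; split; last first.
  by rewrite ler_norml; apply/andP; split; lra.
by apply: le_trans (ler_normB _ _) _; lra.
Qed.

(** Near a point of a central sphere there is a small piece, whose own core is
    essential. A point in a piece is handled inside that piece, where the
    tolerance is at least twice as large; the induction is on the number of times
    it has to be doubled to exceed the diameter of the whole room. *)
Lemma small_essential (N : nat) P v z (e : R) :
  sphere_tree (derived P) v z -> 4 < e * 2 ^+ N ->
  exists f : Sn R n -> tree P v, essential f /\ forall s,
    `|z.1 - (set_val (f s)).1| < e /\ `|z.2 - (set_val (f s)).2| < e.
Proof.
elim: N v z e => [|N IH] v z e Pz eN; have [Pv [u vu Pu]] := sphere_tree_alive Pz.
  exists (core_incl Pv); split=> [|s]; first exact: core_essential.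
  have [d1 d2] := room_diam (sphere_tree_room Pz) (sphere_tree_room (set_valP (core_incl Pv s))).
  by rewrite expr0 mulr1 in eN; split; [exact: le_lt_trans d1 eN|exact: le_lt_trans d2 eN].
have e0 : 0 < e.
  by rewrite -(pmulr_lgt0 _ (exprn_gt0 N.+1 (ltr0n R 2))); exact: lt_trans eN.
have [_ zr [[z1 z2]|[k [w [y [kw vw Py zE]]]]]] := sphere_tree_unfold Pz.
  have e2 : 0 < e / 2 by rewrite divr_gt0.
  have [K heightK] := height_small e2.
  have [k [Kk ku zk]] := center_dense u K z1 e2.
  have y0 := core_incl Pu (to_sphere 0).
  exists (piece_in Pv ku vu \o core_incl Pu); split=> [|s].
    by apply: (essential_retract _ _ (piece_inK Pv ku vu y0)); [exact: piece_in_continuous|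
      exact: piece_out_continuous|exact: core_essential].
  rewrite /comp val_piece_in; set w := set_val _.
  have wr : room w by exact: sphere_tree_room (set_valP (core_incl Pu s)).
  have := place_offset k wr; have := place_height k wr; have := ratio_le k.
  have := heightK k Kk; have := ratio_gt0 k => r0 hk r8 /andP[hl hr] off.
  split.
    rewrite -(subrK (center k) z.1) -addrA; apply: le_lt_trans (ler_normD _ _) _.
    rewrite (splitr e) ltrD// distrC; apply: le_lt_trans off _.
    by move: r0 hk r8; clear ku; lra.
  by rewrite z2 sub0r normrN ger0_norm; move: r0 hk r8 hl hr; clear ku z2; lra.
have Pw : P w by have [] := sphere_tree_alive Py.
have r0 := ratio_gt0 k.
have r2 : 2 * ratio k <= 1.
  have := ratio_le k; have := height_le1 k => h1 r8; clear kw zE; lra.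
have [|g [eg gy]] := IH w y (e / ratio k) Py.
  apply: lt_le_trans eN _; rewrite exprS mulrA ler_pM2r ?exprn_gt0//.
  by rewrite ler_pdivlMr// -mulrA ler_piMr ?(ltW e0).
exists (piece_in Pv kw vw \o g); split=> [|s].
  by apply: (essential_retract _ _ (piece_inK Pv kw vw (core_incl Pw (to_sphere 0)))) => //;
    [exact: piece_in_continuous|exact: piece_out_continuous].
rewrite /comp val_piece_in zE /place /=; have [g1 g2] := gy s.
split.
  by rewrite opprD addrACA subrr add0r -scalerBr normrZ gtr0_norm// mulrC -ltr_pdivlMr.
by rewrite opprD addrACA subrr add0r -mulrBr normrM gtr0_norm// mulrC -ltr_pdivlMr.
Qed.

(** A point of a nested sphere is wild if and only if pieces hang from that
    sphere, and a point lying in infinitely many nested pieces is always wild.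
    Maps near a point of a piece can be studied inside this piece, which is
    clopen and a retract; by coinduction, this leaves the points of the core. If
    no piece hangs from the core it is the whole tree, and small maps to it lie
    in an open hemisphere. The converse is [small_essential]. *)
Theorem fw_sphere_tree P v :
  fw_in R n (sphere_tree P v) = sphere_tree (derived P) v.
Proof.
apply/seteqP; split; last first.
  move=> z Pz; have Pz' : sphere_tree P v z.
    by apply: sphere_tree_mono Pz => u [].
  exists (exist _ z (mem_set Pz')) => //; apply/fwP; first exact: tree_first_countable.
  move=> U [_ /= [[B oB <-] /= Bz BU]].
  have /nbhs_pairP[e e0 eB] : nbhs z B by exact: open_nbhs_nbhs.
  have [N eN] : exists N, 4 < e * 2 ^+ N.
    have e4 : 0 < e / 4 by rewrite divr_gt0.
    have [N HN] := height_small e4; exists N; have := HN N (leqnn N).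
    by rewrite /height exprVn -ltf_pV2 ?posrE ?invr_gt0 ?exprn_gt0// invrK invf_div ltr_pdivrMr// mulrC.
  have [f [ef fz]] := small_essential Pz eN.
  exists f; split=> // _ [s _ <-]; apply: BU.
  by have [? ?] := fz s; exact: eB.
apply: (sphere_tree_coind (Y := fun v => fw_in R n (sphere_tree P v))).
move=> {}v _ [x fwx <-].
have Px : sphere_tree P v (set_val x) by exact: set_valP.
have /fwP small := fwx; have {}small := small (@tree_first_countable P v).
have [Pv xr [cx|[k [u [y [ku vu Py xE]]]]]] := sphere_tree_unfold Px; last first.
  have Pu := sphere_tree_alive Py.
  split=> //; first by split=> //; exists u.
  right; exists k, u, y; split=> //.
  pose y' : tree P u := exist _ y (mem_set Py).
  pose out := @piece_out P v u k ku y'.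
  have inE' : piece_in Pv ku vu y' = x.
    by apply: set_val_inj; rewrite val_piece_in xE.
  have outx : out x = y' by rewrite -inE'; exact: piece_inK.
  exists y' => //; apply/fwP; first exact: tree_first_countable.
  move=> U yU.
  have xU : nbhs x ((out @^-1` U) `&` (set_val @^-1` window k)).
    apply: filterI; first by apply: piece_out_continuous; rewrite -/out outx.
    apply: set_val_continuous; apply: window_open; rewrite xE.
    by apply: window_place; exact: sphere_tree_room Py.
  have [f [[cf nf] fU]] := small _ xU.
  exists (out \o f); split; last first.
    by move=> _ [s _ <-] /=; have [] := fU (f s) (ex_intro2 _ _ s I erefl).
  split.
    by move=> s; apply: continuous_comp; [exact: cf|exact: piece_out_continuous].
  move=> /(null_homotopic_comp (@piece_in_continuous P v u k Pv ku vu)).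
  rewrite (_ : _ \o _ = f)//; apply/funext => s /=; apply: piece_outK.
  by have [] := fU (f s) (ex_intro2 _ _ s I erefl).
split=> //; last by left.
split=> //; apply: contrapT => noChild.
have all_core w : sphere_tree P v w -> core w.
  move=> /sphere_tree_unfold[_ _ [//|[k [u [y [_ vu /sphere_tree_alive Pu _]]]]]].
  by case: noChild; exists u.
have [sx x0] := cx.
pose c : Sn R n := exist _ (set_val x).1 (mem_set sx).
have xU : nbhs x ((fun w : tree P v => dot (set_val w).1 (set_val x).1) @^-1` [set t | 0 < t]).
  have cdot : continuous (fun w : tree P v => dot (set_val w).1 (set_val x).1).
    move=> w; apply: (@continuous_comp _ V R (fun w : tree P v => (set_val w).1)
        (@dot R n ^~ (set_val x).1)).
      by apply: (@continuous_comp _ E _ set_val fst); [exact: set_val_continuous|exact: fst_continuous].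
    exact: (@dot_continuous R n (set_val x).1).
  apply: (cdot x [set t | 0 < t]); apply: open_nbhs_nbhs; split; first exact: open_gt.
  by rewrite /= dotxx (_ : sqnorm _ = 1).
have [f [[cf nf] fU]] := small _ xU; apply: nf.
have -> : f = core_incl Pv \o (@core_proj P v \o f).
  by apply/funext => s /=; rewrite core_incl_proj//; apply: all_core; exact: set_valP.
apply: null_homotopic_comp; first exact: core_incl_continuous.
apply: (@hemisphere_null _ _ _ _ c).
  by move=> s; apply: continuous_comp; [exact: cf|exact: core_proj_continuous].
move=> s; have /= := fU (f s) (ex_intro2 _ _ s I erefl).
have [s1 s2] := all_core _ (set_valP (f s)).
by rewrite /core_proj !set_valE /= normalize_id.
Qed.

Lemma sphere_tree_leaf P v : P v -> (forall u, child v u -> ~ P u) ->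
  homeomorphic (tree P v) (Sn R n).
Proof.
move=> Pv leaf; exists (@core_proj P v), (core_incl Pv); split.
- exact: core_proj_continuous.
- exact: core_incl_continuous.
- move=> z; apply: core_incl_proj.
  by have [_ _ [//|[k [u [y [_ /leaf nPu /sphere_tree_alive//]]]]]] :=
    sphere_tree_unfold (set_valP z).
- exact: core_inclK.
Qed.

End sphere_trees.

(** * Trees of descending sequences of ordinals *)

Lemma injective_unbounded (f : nat -> nat) K : injective f -> exists i, (K <= f i)%N.
Proof.
move=> f_inj; apply: contrapT => small.
have : (size [seq f i | i <- iota 0 K.+1] <= size (iota 0 K))%N.
  apply: uniq_leq_size; first by rewrite map_inj_uniq ?iota_uniq.
  move=> _ /mapP[i _ ->]; rewrite mem_iota /= add0n ltnNge.
  by apply/negP => Kfi; apply: small; exists i.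
by rewrite size_map !size_iota ltnn.
Qed.

Section dense_pieces.
Context (R : realType) (n : nat) (W : Type) (code : W -> nat).
Hypothesis code_inj : injective code.
Local Notation V := 'rV[R]_n.+1.

Definition decode (c : nat) : option W :=
  if pselect (exists w, code w = c) is left H then Some (projT1 (cid H)) else None.

Lemma decodeK w : decode (code w) = Some w.
Proof.
rewrite /decode; case: pselect => [H|[]]; last by exists w.
by congr Some; apply: code_inj; case: cid.
Qed.

(** Pieces are indexed by a type, a rational vector giving the center and a
    multiplicity that makes numbers arbitrarily large, so that the pieces of any
    given type accumulate at every point of the sphere. *)
Definition piece_data k : option (nat * 'rV[rat]_n.+1 * nat) := unpickle k.

Definition piece_kind k : option W :=
  if piece_data k is Some (c, _, _) then decode c else None.

Definition piece_center k : V :=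
  if piece_data k is Some (_, q, _) then normalize (map_mx ratr q) else normalize 0.

Lemma piece_center_sphere k : sphere R n (piece_center k).
Proof.
by rewrite /piece_center; case: piece_data => [[[c q] i]|]; exact: normalize_sphere.
Qed.

Lemma rational_row (x : V) (e : R) : 0 < e ->
  exists q : 'rV[rat]_n.+1, `|x - map_mx ratr q| < e.
Proof.
move=> e0; have e2 : 0 < e / 2 by rewrite divr_gt0.
have near_q i : exists q : rat, `|x 0 i - ratr q| <= e / 2.
  have [|q] := @rat_in_itvoo R (x 0 i - e / 2) (x 0 i + e / 2).
    by rewrite ltrD2l gtrN.
  rewrite in_itv /= => /andP[a b]; exists q.
  by rewrite ler_norml; apply/andP; split; lra.
have [q qP] := choice near_q; exists (\row_i q i).
apply: le_lt_trans (_ : e / 2 < e); last by rewrite gtr_pMr// invf_lt1 ?ltr1n.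
apply: norm_le_coord => [|i]; first exact: ltW.
by rewrite !mxE.
Qed.

Lemma piece_center_dense (u : W) (x : V) (e : R) (K : nat) :
  sphere R n x -> 0 < e ->
  exists k, [/\ (K <= k)%N, piece_kind k = Some u & `|x - piece_center k| < e].
Proof.
move=> sx e0; have x0 := sphere_neq0 sx.
have /(normalize_continuous x0) : nbhs (normalize x) (ball x e).
  by rewrite normalize_id//; exact: nbhsx_ballx.
move=> /nbhs_ballP[d /= d0 dP]; have [q xq] := rational_row x d0.
have [i Ki] : exists i : nat, (K <= pickle (code u, q, i))%N.
  apply: (@injective_unbounded (fun i : nat => pickle (code u, q, i))).
  by move=> i j /(pcan_inj pickleK)[].
exists (pickle (code u, q, i)); rewrite /piece_kind /piece_center /piece_data pickleK.
split=> //; first exact: decodeK.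
have : ball x e (normalize (map_mx ratr q)) by apply: dP; rewrite -ball_normE.
by rewrite -ball_normE.
Qed.

End dense_pieces.

Section ordinal_trees.
Context (R : realType) (n : nat) (l : ordinal_type) (code : ord_succ l -> nat).
Hypothesis code_inj : injective code.
Local Notation V := 'rV[R]_n.+1.
Local Notation W := (ord_succ l).
Implicit Types (u v w : W).

(** The element [None] of [ord_succ l] plays the part of the additional type,
    the only one which is a child of itself. *)
Definition ord_child v u := ord_lt u v \/ v = None /\ u = None.

(** The types present at the stage [w]. *)
Definition alive w : set W := [set v | ~ ord_lt v w].

Let center := @piece_center R n.
Let center_sphere := @piece_center_sphere R n.
Let center_dense := @piece_center_dense R n W code code_inj.

Definition ord_tree (P : set W) v : set (V * R)%type :=
  sphere_tree (piece_kind n code) center ord_child P v.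

(** If [w] is the successor of [v], then [v] is the only type present at the
    stage [v] that has lost all its children. *)
Lemma derived_alive v w : ord_covers v w -> derived ord_child (alive v) = alive w.
Proof.
move=> [vw max_v]; apply/seteqP; split=> a.
  move=> [av [b ab bv]] aw; have [E|//] := max_v _ aw; subst a.
  case: ab => [//|[vN _]].
  by move: vw; rewrite vN.
move=> aw; have va : ord_lt v a.
  by case: (ord_lt_total a w) => [//|-> //|wa]; exact: (@ord_lt_trans W v w a).
split; last by exists v; [left|exact: ord_lt_irr].
by move=> av; apply: (@ord_lt_irr W v); exact: (@ord_lt_trans W v a v).
Qed.

Lemma bigcap_alive w : ~ (exists v, ord_covers v w) ->
  \bigcap_(v in [set v | ord_lt v w]) alive v = alive w.
Proof.
move=> nw; apply/seteqP; split=> u.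
  move=> uP uw; apply: nw; exists u; split=> // v vw.
  case: (ord_lt_total v u) => [vu|->|uv]; [by right|by left|].
  by case: (uP v vw uv).
by move=> uw v /= vw uv; apply: uw; exact: (@ord_lt_trans W u v w).
Qed.

Context (r : W).
Local Notation T := (set_type (ord_tree setT r)).

Lemma fw_stage_ord_tree w :
  set_val @` fw_stage R n T w = ord_tree (alive w) r.
Proof.
elim/(well_founded_ind (@ord_lt_wf W)): w => w IH.
have [[v vw]|nw] := pselect (exists v, ord_covers v w).
  rewrite (fw_stage_covers _ _ _ vw) fw_in_val IH; last by case: vw.
  by rewrite /ord_tree (fw_sphere_tree center_sphere center_dense) (derived_alive vw).
rewrite (fw_stage_lim _ _ _ nw) -(bigcap_alive nw).
have [[v0 v0w]|least] := pselect ([set v | ord_lt v w] !=set0); last first.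
  have -> : [set v | ord_lt v w] = set0.
    by apply/seteqP; split=> // v vw; case: least; exists v.
  rewrite !bigcap_set0; apply/seteqP; split=> [_ [x _ <-]|x Px].
    exact: set_valP.
  by exists (exist _ x (mem_set Px)).
rewrite /ord_tree -sphere_tree_bigcap//; last by exists v0.
apply/seteqP; split=> [_ [x xP <-] v vw|z zP].
  by have := IH v vw; rewrite /ord_tree => <-; exists x => //; exact: xP.
have stage_z v : ord_lt v w -> exists2 x, fw_stage R n T v x & set_val x = z.
  move=> vw; have : ord_tree (alive v) r z by exact: zP.
  by rewrite -IH// => -[x xv <-]; exists x.
have [x _ xz] := stage_z _ v0w; exists x => // v /= /stage_z[y yv yz].
by rewrite (_ : x = y)//; apply: set_val_inj; rewrite xz.
Qed.

(** At the stage [w] the spheres of type [w] are present, without children; they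
    disappear at the next stage. *)
Lemma ord_tree_moves w : w <> None -> (w = r \/ ord_child r w) ->
  ord_tree (derived ord_child (alive w)) r <> ord_tree (alive w) r.
Proof.
move=> wN rw E; pose z0 : V * R := (normalize (0 : V), 0).
have cz0 : core z0 by split=> //; exact: normalize_sphere.
have dead : ~ derived ord_child (alive w) w.
  by move=> [_ [b [bw|[]]]].
case: rw => [wr|rw].
  have : ord_tree (alive w) r z0.
    by apply: core_sphere_tree => //; rewrite -wr; exact: ord_lt_irr.
  by rewrite -E => H; apply: dead; rewrite {2}wr; exact: sphere_tree_alive H.
have [k [_ kw _]] := center_dense w 0 (normalize_sphere (0 : V)) (ltr01 : 0 < 1 :> R).
have : ord_tree (alive w) r (place center k z0).
  apply: (place_sphere_tree center_sphere _ kw rw).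
    case: (rw) => [wr wr'|[-> _] //].
    by apply: (@ord_lt_irr W r); exact: (@ord_lt_trans W r w r wr' wr).
  by apply: core_sphere_tree => //; exact: ord_lt_irr.
have z0r := core_room cz0.
rewrite -E => Pz; have [_ _ [cz|[k' [u [y [ku _ Py zE]]]]]] := sphere_tree_unfold Pz.
  exact: (core_place z0r cz (k := k)).
have [kk' _] := place_inj z0r (sphere_tree_room Py) zE.
move: ku; rewrite -kk' kw => -[wu]; apply: dead; rewrite {2}wu.
exact: sphere_tree_alive Py.
Qed.

End ordinal_trees.

(** * Continua of prescribed rank *)

Lemma homeomorphic_trans (X Y Z : topologicalType) :
  homeomorphic X Y -> homeomorphic Y Z -> homeomorphic X Z.
Proof.
move=> [f [g [cf cg fK gK]]] [f' [g' [cf' cg' fK' gK']]].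
exists (f' \o f), (g \o g'); split=> [x|x||].
- by apply: continuous_comp; [exact: cf|exact: cf'].
- by apply: continuous_comp; [exact: cg'|exact: cg].
- exact: can_comp.
- exact: can_comp.
Qed.

Lemma set_val_image_inj (T : Type) (A : set T) (B C : set (set_type A)) :
  set_val @` B = set_val @` C -> B = C.
Proof.
have sub (D D' : set (set_type A)) : set_val @` D = set_val @` D' -> D `<=` D'.
  move=> E x Dx; have : (set_val @` D') (set_val x) by rewrite -E; exists x.
  by move=> [y D'y /set_val_inj <-].
by move=> E; apply/seteqP; split; apply: sub.
Qed.

(** The root is the greatest element of [l] if there is one, and the
    self-reproducing type otherwise. In both cases every element of [l] occurs
    in the tree, so no stage below [l] is stable, while at [l] only the
    self-reproducing type survives. *)
Theorem continuum_of_rank (R : realType) (n : nat) (l : ordinal_type) :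
  countable_ordinal l ->
  exists X : topologicalType,
    [/\ continuum R X,
        is_fwrk R n X l &
        forall m : ordinal_type, ord_iso l (ord_succ m) ->
          homeomorphic (set_type (fw_iter R n X m)) (Sn R n)].
Proof.
move=> /countable_injP[code0 code0_inj].
pose code (w : ord_succ l) : nat := if w is Some a then (code0 a).+1 else 0%N.
have code_inj : injective code.
  by move=> [a|] [b|] //= [] /code0_inj; rewrite !inE => -> //.
pose is_max (w : l) := forall v, ~ ord_lt w v.
pose r : ord_succ l :=
  if pselect (exists w, is_max w) is left H then Some (projT1 (cid H)) else None.
have r_max (w : l) : is_max w -> r = Some w.
  move=> w_max; rewrite /r; case: pselect => [H|[]]; last by exists w.
  case: cid => w' w'_max /=; congr Some.
  by case: (ord_lt_total w' w) => [/w'_max|//|/w_max].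
have r_child (w : l) : (Some w : ord_succ l) = r \/ ord_child r (Some w).
  rewrite /r; case: pselect => [H|_]; last by right; left.
  case: cid => w' w'_max /=.
  by case: (ord_lt_total w' w) => [/w'_max|->|ww']; [|left|right; left].
have Some_e : @initial_embedding l (ord_succ l) Some.
  by split=> // x [z|//] zx; exists z.
pose T : topologicalType := set_type (@ord_tree R n l code setT r).
have stageE (w : ord_succ l) :
    set_val @` fw_stage R n T w = @ord_tree R n l code (alive w) r.
  exact: fw_stage_ord_tree.
have fw_stageE' (w : ord_succ l) : set_val @` fw_in R n (fw_stage R n T w) =
    @ord_tree R n l code (derived (@ord_child l) (alive w)) r.
  rewrite fw_in_val stageE.
  by rewrite /ord_tree (fw_sphere_tree (@piece_center_sphere R n)
    (@piece_center_dense R n _ code code_inj)).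
have T_continuum : continuum R T.
  by apply: continuum_sphere_tree; exact: piece_center_sphere.
exists T; split=> //.
- apply: is_fwrkP => [w|].
    rewrite -(fw_stage_embed _ _ _ Some_e) => E.
    have /= := congr1 (image^~ set_val) E; rewrite fw_stageE' stageE.
    by apply: ord_tree_moves.
  apply: set_val_image_inj; rewrite fw_stageE' stageE; congr ord_tree.
  apply/seteqP; split=> [v [] //|v aliveN]; split=> //; exists None.
    by case: v aliveN => [a /(_ I)//|_]; right.
  by case.
- move=> m [f [g [fK gK f_mono]]].
have g_mono x y : ord_lt x y <-> ord_lt (g x) (g y) by rewrite f_mono !gK.
pose w0 : l := g None.
have w0_max : is_max w0.
  by move=> v /f_mono; rewrite /w0 gK.
have rE := r_max _ w0_max.
have ge : @initial_embedding m l (g \o Some).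
  split=> [x y xy|x z zx] /=; first by apply/g_mono.
  have : ord_lt (f z) (Some x) by apply/g_mono; rewrite fK.
  case fz : (f z) => [y|//] _; exists y.
  by rewrite -[RHS]fK fz.
have -> : fw_iter R n T m = fw_stage R n T w0.
  apply: (fw_iter_embed _ _ _ ge) => v; split=> [vw0|[y <-]]; last by apply/g_mono.
  have : ord_lt (f v) None by apply/g_mono; rewrite fK.
  case fv : (f v) => [y|//] _; exists y.
  by rewrite /= -fv fK.
rewrite -(fw_stage_embed _ _ _ Some_e).
have [h [cg ch gK' hK]] := subset_image_homeo (fw_stage R n T (Some w0 : ord_succ l)).
apply: (@homeomorphic_trans _ (set_type
    (set_val @` fw_stage R n T (Some w0 : ord_succ l) : set ('rV[R]_n.+1 * R)%type))).
  by exists (@subset_image _ _ _), h.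
rewrite stageE rE.
apply: sphere_tree_leaf.
- exact: piece_center_sphere.
- exact: (@ord_lt_irr (ord_succ l)).
- by move=> u [uw|[]//]; apply.
Qed.

Theorem theorem1p4 (R : realType) (n : nat) :
  (forall X : topologicalType, continuum R X ->
     exists k : ordinal_type, countable_ordinal k /\ is_fwrk R n X k) /\
  (forall l : ordinal_type, countable_ordinal l ->
     exists X : topologicalType,
       [/\ continuum R X,
           is_fwrk R n X l &
           forall m : ordinal_type, ord_iso l (ord_succ m) ->
             homeomorphic (set_type (fw_iter R n X m)) (Sn R n)]).
Proof.
split=> [X|l]; first exact: continuum_rank.
exact: continuum_of_rank.
Qed.
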